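(* Let $p,q\in\mathbb{R}$ with $p\neq0$, $q\neq0$, and let $j\in\mathbb{R}$ with $j\neq n$. If $M,N\in\mathcal{K}_o^n$ and $Q\in\mathcal{S}_o^n$, then $$\lim_{t\rightarrow0}\frac{\widetilde{W}_{q,j}(M+_pt\cdot N,Q)-\widetilde{W}_{q,j}(M,Q)}{t}=\frac{q}{p}\int_{S^{n-1}}h_N^p(v)\,d\widetilde{\mathcal{C}}_{p,q,j}(M,Q,v).$$
   Context: $\mathcal{K}_o^n$ denotes the set of convex bodies (compact convex sets with nonempty interior) in $\mathbb{R}^n$ containing the origin in their interiors; $\mathcal{S}_o^n$ denotes the set of compact sets star-shaped about the origin whose radial function $\rho_Q(x)=\max\{\lambda\ge0:\lambda x\in Q\}$ is positive and continuous on $\mathbb{R}^n\setminus\{0\}$. $h_M(x)=\max\{x\cdot y:y\in M\}$ is the support function, and $du$ is spherical Lebesgue measure on $S^{n-1}$. For $q\in\mathbb{R}$, $j\ne n$, $M\in\mathcal{K}_o^n$, $Q\in\mathcal{S}_o^n$, the $q$-th dual mixed quermassintegral is $\widetilde{W}_{q,j}(M,Q)=\frac1n\int_{S^{n-1}}\rho_M^q(u)\rho_Q^{n-q-j}(u)\,du$. For $M\in\mathcal{K}_o^n$, let $\partial'M$ be the set of boundary points of $M$ with a unique outer unit normal $\nu_M(x)$; the radial Gauss map $\alpha_M(u)=\nu_M(\rho_M(u)u)$ is defined for almost all $u\in S^{n-1}$. For a Borel set $\eta\subseteq S^{n-1}$ the reverse radial Gauss image is $R^*_M(\eta)=\{u\in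 S^{n-1}:\rho_M(u)u\cdot v=h_M(v)\text{ for some }v\in\eta\}$. The $q$-th dual mixed curvature measure is $\widetilde{\mathcal{C}}_{q,j}(M,Q,\eta)=\frac1n\int_{R^*_M(\eta)}\rho_M^q(u)\rho_Q^{n-q-j}(u)\,du$, and for $p\in\mathbb{R}$ the $(p,q)$-dual mixed curvature measure $\widetilde{\mathcal{C}}_{p,q,j}(M,Q,\cdot)$ is the measure with $d\widetilde{\mathcal{C}}_{p,q,j}(M,Q,\cdot)=h_M^{-p}\,d\widetilde{\mathcal{C}}_{q,j}(M,Q,\cdot)$. For $p\ne0$ and $t$ such that $h_M^p+t h_N^p>0$ on $S^{n-1}$, $M+_pt\cdot N$ is the Wulff shape $\{x\in\mathbb{R}^n: x\cdot v\le (h_M^p(v)+th_N^p(v))^{1/p}\ \forall v\in S^{n-1}\}$. *)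

(* Defs.v *)
From HB Require Import structures.
From mathcomp Require Import all_boot all_order all_algebra.
From mathcomp Require Import all_classical all_reals all_analysis.

Set Implicit Arguments.
Unset Strict Implicit.
Unset Printing Implicit Defensive.

Import Order.TTheory GRing.Theory Num.Def Num.Theory.
Import numFieldNormedType.Exports.

Local Open Scope classical_set_scope.
Local Open Scope ring_scope.

(* R^n is 'rV[R]_n (with the library's product
   topology, i.e. the usual topology of R^n); for measure theory we use the
   isomorphic copy n.-tuple R, which carries the library's product
   (= Borel) sigma-algebra. *)

Section Geometry.
Variables (R : realType) (n : nat).
Local Notation V := 'rV[R]_n.

Definition tup2rv (t : n.-tuple R) : V := \row_i tnth t i.

Definition dot (x y : V) : R := \sum_(i < n) x ord0 i * y ord0 i.
Definition enorm (x : V) : R := Num.sqrt (dot x x).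
Definition sphere : set V := [set u | enorm u = 1].
Definition normalize (x : V) : V := (enorm x)^-1 *: x.

Definition radial (Q : set V) (x : V) : R := sup [set l : R | 0 <= l /\ Q (l *: x)].
Definition hsupp (M : set V) (x : V) : R := sup [set dot x y | y in M].

Definition convex_set (M : set V) : Prop :=
  forall x y, M x -> M y -> forall t : R, 0 <= t <= 1 -> M ((1 - t) *: x + t *: y).

Definition convex_body_o (M : set V) : Prop :=
  compact M /\ convex_set M /\ interior M 0.

Definition star_body_o (Q : set V) : Prop :=
  compact Q /\ (forall x, Q x -> forall t : R, 0 <= t <= 1 -> Q (t *: x)) /\
  (forall x, x != 0 -> 0 < radial Q x) /\
  {within ~` [set 0], continuous (radial Q)}.

Definition wulff_p (M N : set V) (p t : R) : set V :=
  [set x | forall v, sphere v ->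
     dot x v <= (hsupp M v `^ p + t * hsupp N v `^ p) `^ (p^-1)].

Definition is_lebesgue (lam : {measure set (n.-tuple R) -> \bar R}) : Prop :=
  forall a b : n.-tuple R, (forall i, tnth a i <= tnth b i) ->
    lam [set t | forall i, tnth a i < tnth t i <= tnth b i] =
      (\prod_(i < n) (tnth b i - tnth a i))%:E.

(* Spherical Lebesgue measure, defined as the cone measure:
   int_{S^{n-1}} f du := n * int_{0 < |x| <= 1} f(x/|x|) dx,
   restricted to the set A of the sphere (extended-real valued). *)
Definition sph_int (lam : {measure set (n.-tuple R) -> \bar R})
    (A : set V) (f : V -> R) : \bar R :=
  (n%:R)%:E * \int[lam]_(t in [set t | (0 < enorm (tup2rv t) <= 1)%R /\
                                     A (normalize (tup2rv t))])
                 (f (normalize (tup2rv t)))%:E.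

Definition dual_quermass lam (q j : R) (M Q : set V) : R :=
  (n%:R)^-1 * fine (sph_int lam sphere
     (fun u => radial M u `^ q * radial Q u `^ (n%:R - q - j))).

Definition rev_radial_gauss (M : set V) (eta : set V) : set V :=
  [set u | sphere u /\ exists2 v, eta v & dot (radial M u *: u) v = hsupp M v].

Definition dual_curv lam (q j : R) (M Q : set V) (eta : set V) : \bar R :=
  (n%:R)^-1%:E * sph_int lam (rev_radial_gauss M eta)
     (fun u => radial M u `^ q * radial Q u `^ (n%:R - q - j))%R.

End Geometry.

Arguments tup2rv {R n}.
Arguments sphere {R n}.

(* Main.v *)
(** On a direction u the reciprocal of the radial function of M +_p t.N is the
    maximum over unit v of u.v / h_t(v), where h_t = (h_M^p + t h_N^p)^(1/p).
    Writing phi = h_N^p h_M^(-p) and comparing maximizers v_t and v_0 at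
    parameters t and 0, one finds that (rho_t(u) / rho_0(u))^p lies between
    1 + t phi(v_t) and 1 + t phi(v_0).  This gives difference quotients bounded
    uniformly in u, converging at each u with a unique maximizer v_0, that is,
    a unique normal; dominated convergence and the change of variables
    v = alpha_M(u) conclude.

    Uniqueness of the normal almost everywhere comes from the additivity of the
    dual mixed curvature measure: for disjoint closed sets A and B of normals,
    C(A u B) = C(A) + C(B) forces the directions having normals in both A and B
    to be a null set. *)
Require Import Defs.
From HB Require Import structures.
From mathcomp Require Import all_boot all_order all_algebra.
From mathcomp Require Import all_classical all_reals all_analysis.
From mathcomp Require Import measurable_realfun ring lra.

Import Order.TTheory GRing.Theory Num.Def Num.Theory.
Import numFieldNormedType.Exports.

Local Open Scope classical_set_scope.
Local Open Scope ring_scope.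

(** * Dot products and support functions *)

(** The function [h_t] need not be the support function of its Wulff shape, so the perturbed bodies
    are described by their radial functions alone. The gauge whose reciprocal this is happens to be
    the support function of the compact set of points v / h_t(v), which yields continuity and
    maximizers.

    The additivity argument succeeds because the density rho_M^q rho_Q^(n-q-j) is positive with
    finite integral, while directions with normals in both A and B count once in C(A u B) and twice
    in C(A) + C(B). Countably many pairs of closed half-spaces separate all pairs of distinct
    normals, so a countable union of null sets contains every irregular direction. *)

Section Euclidean.
Context {R : realType} {n : nat}.
Implicit Types (x y z : 'rV[R]_n) (a : R) (K M : set 'rV[R]_n).

Lemma dotC x y : dot x y = dot y x.
Proof. by apply: eq_bigr => i _; rewrite mulrC. Qed.

Lemma dotDr x y z : dot x (y + z) = dot x y + dot x z.
Proof. by rewrite -big_split; apply: eq_bigr => i _; rewrite mxE mulrDr. Qed.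

Lemma dotZr a x y : dot x (a *: y) = a * dot x y.
Proof. by rewrite mulr_sumr; apply: eq_bigr => i _; rewrite mxE mulrCA. Qed.

Lemma dotDl x y z : dot (x + y) z = dot x z + dot y z.
Proof. by rewrite dotC dotDr !(dotC z). Qed.

Lemma dotZl a x y : dot (a *: x) y = a * dot x y.
Proof. by rewrite dotC dotZr dotC. Qed.

Lemma dotNr x y : dot x (- y) = - dot x y.
Proof. by rewrite -scaleN1r dotZr mulN1r. Qed.

Lemma dotNl x y : dot (- x) y = - dot x y.
Proof. by rewrite dotC dotNr dotC. Qed.

Lemma dot_ge0 x : 0 <= dot x x.
Proof. by apply: sumr_ge0 => i _; rewrite -expr2 sqr_ge0. Qed.

Lemma dot_gt0 x : (0 < dot x x) = (x != 0).
Proof.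
rewrite lt_def dot_ge0 andbT; congr (~~ _).
apply/eqP/eqP => [/eqP|->]; last by rewrite /dot big1// => i _; rewrite mxE mul0r.
rewrite psumr_eq0 => [/allP xx|i _]; last by rewrite -expr2 sqr_ge0.
apply/rowP => i; rewrite mxE; apply/eqP.
by have := xx i (mem_index_enum i); rewrite mulf_eq0 orbb.
Qed.

Lemma enorm_gt0 x : (0 < enorm x) = (x != 0).
Proof. by rewrite sqrtr_gt0 dot_gt0. Qed.

Lemma sphereE x : sphere x <-> dot x x = 1.
Proof.
rewrite /sphere/= /enorm; split => [xx|->]; last by rewrite sqrtr1.
by rewrite -[LHS]sqr_sqrtr ?dot_ge0// xx expr1n.
Qed.

Lemma sphere_neq0 x : sphere x -> x != 0.
Proof. by rewrite -dot_gt0 => /sphereE ->. Qed.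

Lemma normalize_sphere x : x != 0 -> sphere (normalize x).
Proof.
move=> x0; apply/sphereE; rewrite dotZl dotZr mulrA -expr2.
rewrite -(sqr_sqrtr (dot_ge0 x)) -exprMn mulVf ?expr1n//.
by rewrite gt_eqF// enorm_gt0.
Qed.

(** Row vectors carry the maximum norm, hence the factor [n]; the constant only enters a Lipschitz
    bound for support functions. *)
Lemma ler_dot x y : `|dot x y| <= n%:R * (`|x| * `|y|).
Proof.
have coord_le (z : 'rV[R]_n) i : `|z ord0 i| <= `|z|.
  by rewrite [leRHS]/normr /= mx_normrE; apply/bigmax_geP; right => /=;
    exists (ord0, i).
have -> : n%:R * (`|x| * `|y|) = \sum_(i < n) `|x| * `|y|.
  by rewrite sumr_const card_ord mulr_natl.
rewrite (le_trans (ler_norm_sum _ _ _))//; apply: ler_sum => i _.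
by rewrite normrM ler_pM.
Qed.

Lemma continuous_dot {T : topologicalType} (f g : T -> 'rV[R]_n) t :
  {for t, continuous f} -> {for t, continuous g} ->
  {for t, continuous (fun s => dot (f s) (g s))}.
Proof.
move=> fx gy; rewrite /dot /prop_for /continuous_at.
apply: (@cvg_big _ _ _ _ xpredT _ T (nbhs t)) => [|i _]; first exact: add_continuous.
apply: (@cvgM _ _ (nbhs t)).
  by apply: (cvg_comp f (fun z => z ord0 i) fx); exact: coord_continuous.
by apply: (cvg_comp g (fun z => z ord0 i) gy); exact: coord_continuous.
Qed.

Lemma continuous_dotr x : continuous (dot x).
Proof.
move=> y; apply: (@continuous_dot _ (fun=> x) (fun z => z) y).
  exact: cst_continuous.
exact: cvg_id.
Qed.

Lemma continuous_enorm : continuous (@enorm R n).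
Proof.
move=> x; apply: (cvg_comp (fun y => dot y y) Num.sqrt _ (@sqrt_continuous R _)).
by apply: (@continuous_dot _ (fun z => z) (fun z => z) x); exact: cvg_id.
Qed.

Lemma continuous_normalize x : x != 0 -> {for x, continuous (@normalize R n)}.
Proof.
move=> x0; apply: (@continuousZ _ _ _ (fun y => (enorm y)^-1) (fun y => y)).
  by apply: continuousV; [rewrite gt_eqF// enorm_gt0|exact: continuous_enorm].
exact: cvg_id.
Qed.

Lemma sphere_compact : compact (@sphere R n).
Proof.
apply: bounded_closed_compact; last first.
  exact: (iffLR (continuous_closedP _) continuous_enorm _ (@closed_eq _ 1)).
exists 1; split => // r r1 x /sphereE xx.
apply: le_trans (ltW r1); rewrite /normr /= mx_normrE.
apply/bigmax_leP; split => // -[i k] _ /=.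
rewrite ord1 -(@expr_le1 _ 2)// real_normK ?num_real// -xx /dot (bigD1 k)//=.
rewrite -expr2 lerDl.
by apply: sumr_ge0 => l _; rewrite -expr2 sqr_ge0.
Qed.

Lemma hsupp_attained {K} x : compact K -> K !=set0 ->
  exists2 y, K y & hsupp K x = dot x y.
Proof.
move=> cK K0.
have [y /set_mem Ky ymax] : exists2 y, y \in K & forall z, z \in K -> dot x z <= dot x y.
  apply: compact_EVT_max => //; apply: continuous_subspaceT => z.
  exact: continuous_dotr.
exists y => //; apply/eqP; rewrite eq_le; apply/andP; split.
  by apply: ge_sup; [exists (dot x y), y|move=> _ [z /mem_set Kz <-]; exact: ymax].
apply: ub_le_sup; last by exists y.
by exists (dot x y) => _ [z /mem_set Kz <-]; exact: ymax.
Qed.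

Lemma hsupp_ge {K} x {y} : compact K -> K y -> dot x y <= hsupp K x.
Proof.
move=> cK Ky; apply: ub_le_sup; last by exists y.
have : compact (dot x @` K).
  apply: continuous_compact cK; apply: continuous_subspaceT => z.
  exact: continuous_dotr.
by move=> /(compact_has_sup (ex_intro _ _ (ex_intro2 _ _ y Ky erefl))) [].
Qed.

(** A maximizer for [x] is a competitor for [y], so the support function of a bounded set is
    Lipschitz. *)
Lemma continuous_hsupp {K} : compact K -> K !=set0 -> continuous (hsupp K).
Proof.
move=> cK K0.
have [C [_ KC]] := compact_bounded cK.
have {}KC y : K y -> `|y| <= `|C| + 1.
  by apply: KC; rewrite (le_lt_trans (ler_norm _))// ltrDl.
(* The final [+ 1] keeps [L] positive even for [n = 0]. *)
pose L := n%:R * (`|C| + 1) + 1.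
have L0 : 0 < L by rewrite ltr_wpDl// mulr_ge0// addr_ge0.
have lip x y : hsupp K x - hsupp K y <= L * `|x - y|.
  have [z Kz ->] := hsupp_attained x cK K0.
  rewrite lerBlDr; apply: le_trans (lerD (lexx _) (hsupp_ge y cK Kz)).
  rewrite -lerBlDr -dotNl -dotDl (le_trans (ler_norm _))//.
  rewrite (le_trans (ler_dot _ _))// /L mulrDl -mulrA mul1r ler_wpDr//.
  by rewrite ler_wpM2l// mulrC ler_wpM2r// KC.
move=> x; apply/(@cvgrPdist_lt _ _ _ (nbhs (x : 'rV[R]_n))) => e e0; near=> y.
have xy : L * `|x - y| < e.
  rewrite -ltr_pdivlMl//; near: y; apply: cvgr_dist_lt => //.
  by rewrite mulr_gt0// invr_gt0.
rewrite (le_lt_trans _ xy)// ler_norml lip andbT lerNl opprB distrC.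
by rewrite (le_trans (lip _ _)).
Unshelve. all: by end_near. Qed.

End Euclidean.

(** * Wulff shapes and their gauges *)

Section Wulff.
Context {R : realType} {n : nat}.
Implicit Types (x y u v : 'rV[R]_n) (A M N : set 'rV[R]_n) (h : 'rV[R]_n -> R).

Lemma dot_subZ x y (s : R) :
  dot (x - s *: y) (x - s *: y) = dot x x - 2 * s * dot x y + s ^+ 2 * dot y y.
Proof.
rewrite dotDl !dotDr !dotNr !dotNl !dotZl !dotZr (dotC y x); ring.
Qed.

Section body.
Variable M : set 'rV[R]_n.
Hypothesis bM : convex_body_o M.

Lemma body_neq0 : M !=set0.
Proof. by exists 0; case: bM => _ [_]; exact: nbhs_singleton. Qed.

Lemma body_compact : compact M. Proof. by case: bM. Qed.

Lemma continuous_hsupp_body : continuous (hsupp M).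
Proof. exact: continuous_hsupp body_compact body_neq0. Qed.

Lemma hsupp_body_gt0 v : v != 0 -> 0 < hsupp M v.
Proof.
move=> v0; case: bM => cM [_ /nbhs_ballP[e /= e0 eM]].
have nv0 : 0 < `|v| by rewrite normr_gt0.
pose c := e / 2 / `|v|.
have c0 : 0 < c by rewrite !divr_gt0.
have Mcv : M (c *: v).
  apply: eM; rewrite mx_norm_ball /ball_/= sub0r normrN normrZ gtr0_norm//.
  by rewrite /c divfK ?gt_eqF// ltr_pdivrMr// ltr_pMr// ltr1n.
apply: lt_le_trans (hsupp_ge v cM Mcv).
by rewrite dotZr mulr_gt0// dot_gt0.
Qed.

(** If [x] lies outside [M] and [y] is the point of [M] nearest to [x], the direction [x - y] gives
    a half-space containing [M] but not [x]. Thus [radial_wulff] applies to [M] as to the perturbed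
    bodies. *)
Lemma body_wulff : [set x | forall v, sphere v -> dot x v <= hsupp M v] = M.
Proof.
case: bM => cM [convM _].
apply/seteqP; split => x /=; last first.
  by move=> Mx v _; rewrite dotC hsupp_ge.
move=> xM; apply: contrapT => Mx.
have [y /set_mem My ymin] : exists2 y, y \in M &
    forall z, z \in M -> dot (x - y) (x - y) <= dot (x - z) (x - z).
  apply: compact_EVT_min => //; first exact: body_neq0.
  have cB : continuous (fun y => x - y) by move=> y; apply: continuousB;
    [exact: cst_continuous|exact: cvg_id].
  apply: continuous_subspaceT => z.
  by apply: (@continuous_dot _ _ _ (fun y => x - y) (fun y => x - y)); exact: cB.
set w := x - y.
have w0 : w != 0 by rewrite subr_eq0; apply/eqP => xy; apply: Mx; rewrite xy.
(* the first-order optimality condition at the point of M nearest to x *)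
have wM z : M z -> dot w (z - y) <= 0.
  move=> Mz; rewrite leNgt; apply/negP => wz.
  have D0 := dot_ge0 (z - y); set D := dot (z - y) (z - y) in D0.
  (* This step length keeps the quadratic term [s ^+ 2 * D] below the linear gain
     [2 * s * dot w (z - y)]; [D + 1] avoids dividing by zero. *)
  pose s := Num.min 1 (dot w (z - y) / (D + 1)).
  have s0 : 0 < s by rewrite lt_min ltr01 divr_gt0// ltr_wpDl.
  have s1 : s <= 1 by rewrite ge_min lexx.
  have sD : s * (D + 1) <= dot w (z - y).
    by rewrite -ler_pdivlMr ?ltr_wpDl// ge_min lexx orbT.
  have /mem_set/ymin : M ((1 - s) *: y + s *: z).
    by apply: convM => //; rewrite (ltW s0).
  have -> : x - ((1 - s) *: y + s *: z) = w - s *: (z - y).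
    by rewrite /w scalerBl scale1r scalerBr; apply/rowP => i; rewrite !mxE; ring.
  rewrite -/w leNgt => /negP; apply.
  by rewrite dot_subZ -/D; nra.
have Sw := normalize_sphere _ w0.
have := xM _ Sw.
have [z Mz ->] := hsupp_attained (normalize w) cM body_neq0.
rewrite dotZl dotC dotZl ler_pM2l ?invr_gt0 ?enorm_gt0// leNgt => /negP; apply.
rewrite (@le_lt_trans _ _ (dot w y))//.
  by rewrite -subr_le0 -dotNr -dotDr wM.
by rewrite -subr_gt0 -dotNr -dotDr dot_gt0.
Qed.

End body.

(* For h > 0 on the sphere this is [sup {x.v / h(v) : v in A, |v| = 1}]; when A
   is the whole space it is the gauge of the Wulff shape of h, that is
   the reciprocal of its radial function. *)
Definition gauge h A x :=
  hsupp [set (h v)^-1 *: v | v in A `&` sphere] x.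

Section gauge.
Variables (h : 'rV[R]_n -> R) (A : set 'rV[R]_n).
Hypothesis hc : forall v, sphere v -> {for v, continuous h}.
Hypothesis h0 : forall v, sphere v -> 0 < h v.
Hypothesis cA : closed A.

Let K := [set (h v)^-1 *: v | v in A `&` sphere].

Let cK : compact K.
Proof.
apply: continuous_compact.
  apply/continuous_in_subspaceT => v /set_mem[_ Sv].
  apply: (@continuousZ _ _ _ (fun v => (h v)^-1) (fun v => v)); last exact: cvg_id.
  by apply: continuousV (hc _ Sv); rewrite gt_eqF// h0.
by rewrite setIC; apply: compact_closedI => //; exact: sphere_compact.
Qed.

Lemma gauge_ge x {v} : A v -> sphere v -> dot x v / h v <= gauge h A x.
Proof.
by move=> Av Sv; rewrite mulrC -dotZr hsupp_ge//; exists v.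
Qed.

Hypothesis A0 : A `&` sphere !=set0.

Let K0 : K !=set0. Proof. by case: A0 => v ASv; exists ((h v)^-1 *: v), v. Qed.

Lemma gauge_attained x :
  exists v, [/\ A v, sphere v & gauge h A x = dot x v / h v].
Proof.
have [_ [v [Av Sv] <-] xv] := hsupp_attained x cK K0.
by exists v; split => //; rewrite /gauge xv dotZr mulrC.
Qed.

Lemma continuous_gauge : continuous (gauge h A).
Proof. exact: continuous_hsupp cK K0. Qed.

End gauge.

Lemma sphere_neq_set0 x : x != 0 -> setT `&` @sphere R n !=set0.
Proof. by move=> /normalize_sphere Sx; exists (normalize x). Qed.

Section radial.
Variable h : 'rV[R]_n -> R.
Hypothesis hc : forall v, sphere v -> {for v, continuous h}.
Hypothesis h0 : forall v, sphere v -> 0 < h v.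

Lemma gauge_gt0 x : x != 0 -> 0 < gauge h setT x.
Proof.
move=> x0; have Sx := normalize_sphere _ x0.
apply: lt_le_trans (gauge_ge h setT hc h0 closedT x I Sx).
by rewrite divr_gt0 ?h0// dotZr mulr_gt0 ?dot_gt0// invr_gt0 enorm_gt0.
Qed.

Lemma radial_wulff x : x != 0 ->
  radial [set y | forall v, sphere v -> dot y v <= h v] x = (gauge h setT x)^-1.
Proof.
move=> x0; have g0 := gauge_gt0 _ x0.
rewrite /radial.
suff -> : [set l : R | 0 <= l /\ [set y | forall v, sphere v -> dot y v <= h v] (l *: x)]
    = [set` `[0, (gauge h setT x)^-1]].
  by rewrite sup_itvcc// invr_ge0 ltW.
apply/seteqP; split => l /=; rewrite in_itv/=.
  move=> [l0 lh]; rewrite l0/= -[leRHS]mul1r ler_pdivlMr//.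
  have [v [_ Sv ->]] := gauge_attained h setT hc h0 closedT (sphere_neq_set0 _ x0) x.
  by rewrite mulrA ler_pdivrMr ?h0// mul1r -dotZl lh.
move=> /andP[l0]; rewrite -[leRHS]mul1r ler_pdivlMr// => lg; split => // v Sv.
rewrite dotZl -[leRHS]mul1r -ler_pdivrMr ?h0// -mulrA (le_trans _ lg)// ler_wpM2l//.
exact: gauge_ge.
Qed.

End radial.

End Wulff.

(** * Perturbation of the gauge under L_p addition *)

Section PowerMean.
Context {R : realType}.

Lemma continuous_powR (r x : R) : 0 < x -> {for x, continuous (fun y => y `^ r)}.
Proof.
move=> x0; have [dr _] := is_derive1_powR r x0.
by apply: differentiable_continuous; exact/derivable1_diffP.
Qed.

(** Caratheodory's form of the derivative of (1 + s)^r at 0: since [d] is continuous there, the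
    chain rule applies to increments that may vanish. *)
Lemma powR_slope (r : R) : exists d : R -> R,
  [/\ d s @[s --> 0] --> r & forall s, (1 + s) `^ r - 1 = d s * s].
Proof.
exists (fun s => if s == 0 then r else s^-1 * ((1 + s) `^ r - 1)); split; last first.
  move=> s; case: eqVneq => [->|s0]; first by rewrite addr0 powR1 subrr mulr0.
  by rewrite mulrAC mulVf// mul1r.
have [dr Dr] := is_derive1_powR r (@ltr01 R).
have r1 : 1 `^ r = 1 :> R by rewrite powR1.
have : h^-1 *: ((h *: 1 + 1) `^ r - 1) @[h --> 0^'] --> r.
  have -> : (fun h : R => h^-1 *: ((h *: 1 + 1) `^ r - 1)) =
      fun h : R => h^-1 *: ((h *: 1 + 1) `^ r - 1 `^ r).
    by apply/funext => h; rewrite r1.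
  rewrite powR1 mulr1 in Dr; rewrite -[X in _ --> X]Dr.
  exact: dr.
move=> /cvgrPdist_lt rD; apply/cvgrPdist_lt => e e0.
have := rD _ e0; rewrite !near_withinE => rDe; near=> s.
case: eqVneq => [_|s0]; first by rewrite subrr normr0.
have /(_ s0) : s != 0 -> `|r - s^-1 *: ((s *: 1 + 1) `^ r - 1)| < e by near: s.
by rewrite /GRing.scale/= mulr1 (addrC 1 s).
Unshelve. all: by end_near. Qed.

Lemma mulf_div_cancel (a b c : R) : c != 0 -> c * (a / (b * c)) = a / b.
Proof. by move=> c0; rewrite invfM mulrCA [c * _]mulrCA mulfV// mulr1. Qed.

(** Raising to the power [p] reverses inequalities when [p < 0]; bounds by [min] and [max] cover
    both signs. *)
Lemma between_powR (p a b c : R) : p != 0 -> 0 < a -> 0 < b ->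
  a `^ p^-1 <= c <= b `^ p^-1 -> Num.min a b <= c `^ p <= Num.max a b.
Proof.
move=> p0 a0 b0 /andP[ac cb].
have ap : (a `^ p^-1) `^ p = a by rewrite -powRrM mulVf// powRr1// ltW.
have bp : (b `^ p^-1) `^ p = b by rewrite -powRrM mulVf// powRr1// ltW.
have c0 : 0 < c by rewrite (lt_le_trans _ ac)// powR_gt0.
have [p_gt0|p_lt0] := ltP 0 p.
  rewrite ge_min le_max -{1}ap -{2}bp !ge0_ler_powR ?orbT ?nnegrE ?powR_ge0//;
  by rewrite ltW.
have Np : 0 <= - p by rewrite oppr_ge0.
have mono x y : 0 < x -> x <= y -> y `^ p <= x `^ p.
  move=> x0 xy; rewrite -(opprK p) !(powRN _ (- p)).
  have y0 := lt_le_trans x0 xy.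
  by rewrite lef_pV2 ?posrE ?powR_gt0// ge0_ler_powR// nnegrE ltW.
have cpa := mono _ _ (powR_gt0 p^-1 a0) ac; have bcp := mono _ _ c0 cb.
by rewrite ap in cpa; rewrite bp in bcp; rewrite ge_min le_max cpa bcp orbT.
Qed.

(** Meant for [a] = t phi(v_t) and [b] = t phi(v_0): the first bound will be uniform in the
    direction, the second measures the deviation from the expected first-order term. *)
Lemma between_norm (a b c m : R) : `|a| <= m -> `|b| <= m ->
  Num.min (1 + a) (1 + b) <= c <= Num.max (1 + a) (1 + b) ->
  `|c - 1| <= m /\ `|c - 1 - b| <= `|a - b|.
Proof.
rewrite !ler_norml => /andP[? ?] /andP[? ?].
have [ab|ab] := leP (1 + a) (1 + b) => /andP[? ?].
  rewrite (@ler0_norm _ (a - b)); last by lra.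
  by split; apply/andP; split; lra.
rewrite (@gtr0_norm _ (a - b)); last by lra.
by split; apply/andP; split; lra.
Qed.

(** [G] and [s] stand for the unperturbed and perturbed gauges, [f0] and [f] for the factors at v_0
    and v_t. From [G <= (1 + eta) * s] and [f >= 1 - eta] the gap is at most
    [2 * eta * G / (1 + eta)], so the constant 8 is generous. *)
Lemma near_one_gap (G s f f0 eta m : R) : 0 < G -> 0 < s -> 0 < eta <= 2^-1 ->
  eta * (8 * G) <= m -> `|f - 1| < eta -> `|f0 - 1| < eta -> G <= f0 * s ->
  G - f * s < m.
Proof.
rewrite !ltr_norml => G0 s0 /andP[e0 e2] em /andP[? ?] /andP[? ?] Gs.
apply: lt_le_trans em.
have fs : s * (1 - eta) <= f * s by rewrite mulrC ler_wpM2r ?(ltW s0)//; lra.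
have Gs' : G <= (1 + eta) * s.
  by apply: le_trans Gs _; rewrite ler_wpM2r ?(ltW s0)//; lra.
nra.
Qed.

End PowerMean.

(** * Difference quotients of powers of the gauge *)

Section Perturbation.
Context {R : realType} {n : nat}.
Variables (h k : 'rV[R]_n -> R) (p : R).
Hypothesis p0 : p != 0.
Hypothesis hc : forall v, sphere v -> {for v, continuous h}.
Hypothesis kc : forall v, sphere v -> {for v, continuous k}.
Hypothesis h0 : forall v, sphere v -> 0 < h v.
Hypothesis k0 : forall v, sphere v -> 0 < k v.

Definition lp_comb t (v : 'rV[R]_n) := (h v `^ p + t * k v `^ p) `^ p^-1.

Definition lp_ratio (v : 'rV[R]_n) := k v `^ p * h v `^ (- p).

Lemma lp_ratio_continuous v : {for v, continuous h} -> {for v, continuous k} ->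
  0 < h v -> 0 < k v -> {for v, continuous lp_ratio}.
Proof.
move=> hv kv hv0 kv0.
apply: (@continuousM _ _ (fun v => k v `^ p) (fun v => h v `^ (- p))).
  exact: (@continuous_comp _ _ _ k (fun y => y `^ p)) kv (continuous_powR _ _ kv0).
exact: (@continuous_comp _ _ _ h (fun y => y `^ (- p))) hv (continuous_powR _ _ hv0).
Qed.

Lemma lp_ratio_gt0 v : sphere v -> 0 < lp_ratio v.
Proof. by move=> Sv; rewrite mulr_gt0// powR_gt0 ?h0 ?k0. Qed.

Lemma lp_ratio_bounded : exists2 B : R, 0 < B & forall v, sphere v -> lp_ratio v <= B.
Proof.
have : compact (lp_ratio @` sphere).
  apply: continuous_compact sphere_compact.
  apply/continuous_in_subspaceT => v /set_mem Sv.
  exact: lp_ratio_continuous (hc _ Sv) (kc _ Sv) (h0 _ Sv) (k0 _ Sv).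
move=> /compact_bounded[C [_ CB]]; exists (`|C| + 1); first by rewrite ltr_pwDr.
move=> v Sv; rewrite (le_trans (ler_norm _))//.
by apply: CB; [rewrite (le_lt_trans (ler_norm _))// ltrDl|exists v].
Qed.

Lemma lp_combE t v : sphere v -> 0 <= 1 + t * lp_ratio v ->
  lp_comb t v = h v * (1 + t * lp_ratio v) `^ p^-1.
Proof.
move=> Sv tv; have hv := h0 _ Sv.
rewrite /lp_comb.
have -> : h v `^ p + t * k v `^ p = h v `^ p * (1 + t * lp_ratio v).
  by rewrite /lp_ratio powRN; field; rewrite gt_eqF// powR_gt0.
by rewrite powRM ?powR_ge0// -powRrM mulfV// powRr1// ltW.
Qed.

Variable B : R.
Hypothesis B0 : 0 < B.
Hypothesis ratioB : forall v, sphere v -> lp_ratio v <= B.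

(** [|t| * B <= 2^-1] is the smallness condition used throughout: it keeps 1 + t phi away from 0 on
    the whole sphere, so that the perturbed function is positive. *)
Lemma lp_factor_ge t v : `|t| * B <= 2^-1 -> sphere v -> 2^-1 <= 1 + t * lp_ratio v.
Proof.
move=> tB Sv; have rv := lp_ratio_gt0 _ Sv; have rB := ratioB _ Sv.
have : `|t * lp_ratio v| <= 2^-1.
  by rewrite normrM (le_trans _ tB)// ler_wpM2l// gtr0_norm.
rewrite ler_norml => /andP[+ _]; lra.
Qed.

Lemma lp_factor_gt0 t v : `|t| * B <= 2^-1 -> sphere v -> 0 < 1 + t * lp_ratio v.
Proof.
by move=> tB Sv; apply: lt_le_trans (lp_factor_ge _ _ tB Sv); rewrite invr_gt0.
Qed.

Lemma lp_comb_gt0 t v : `|t| * B <= 2^-1 -> sphere v -> 0 < lp_comb t v.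
Proof.
move=> tB Sv; have tv := lp_factor_gt0 _ _ tB Sv.
by rewrite lp_combE ?mulr_gt0 ?h0 ?powR_gt0// ltW.
Qed.

Lemma lp_comb_continuous t v : `|t| * B <= 2^-1 -> sphere v ->
  {for v, continuous (lp_comb t)}.
Proof.
move=> tB Sv; have tv := lp_factor_gt0 _ _ tB Sv.
have pow (f : 'rV[R]_n -> R) r : 0 < f v -> {for v, continuous f} ->
    {for v, continuous (fun v => f v `^ r)}.
  move=> fv cf; apply: (@continuous_comp _ _ _ f (fun y => y `^ r)) => //.
  exact: continuous_powR.
apply: (pow (fun v => h v `^ p + t * k v `^ p)).
  have -> : h v `^ p + t * k v `^ p = h v `^ p * (1 + t * lp_ratio v).
    by rewrite /lp_ratio powRN; field; rewrite gt_eqF// powR_gt0// h0.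
  by rewrite mulr_gt0 ?powR_gt0 ?h0.
apply: (@continuousD _ _ _ (fun v => h v `^ p) (fun v => t * k v `^ p)).
  by apply: pow; [exact: h0|exact: hc].
apply: (@continuousM _ _ (fun=> t) (fun v => k v `^ p)); first exact: cst_continuous.
by apply: pow; [exact: k0|exact: kc].
Qed.

Let g t := gauge (lp_comb t) setT.
Let g0 := gauge h setT.

(** Each gauge is tested at the maximizer of the other: [v] in the unperturbed gauge gives the lower
    bound, [v0] in the perturbed one the upper bound. *)
Lemma gauge_lp_comb_between t x v0 : `|t| * B <= 2^-1 -> x != 0 ->
  sphere v0 -> g0 x = dot x v0 / h v0 ->
  exists v, [/\ sphere v, g t x = dot x v / lp_comb t v &
    (1 + t * lp_ratio v) `^ p^-1 <= g0 x / g t x <= (1 + t * lp_ratio v0) `^ p^-1].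
Proof.
move=> tB x0 Sv0 gv0.
have hc' := fun v => @lp_comb_continuous t v tB.
have h0' := fun v => @lp_comb_gt0 t v tB.
have [v [_ Sv gv]] := gauge_attained _ setT hc' h0' closedT (sphere_neq_set0 _ x0) x.
exists v; split => //.
have gt0 : 0 < g t x := gauge_gt0 _ hc' h0' _ x0.
have tv := lp_factor_gt0 _ _ tB Sv; have tv0 := lp_factor_gt0 _ _ tB Sv0.
have fv : 0 < (1 + t * lp_ratio v) `^ p^-1 by rewrite powR_gt0.
have fv0 : 0 < (1 + t * lp_ratio v0) `^ p^-1 by rewrite powR_gt0.
apply/andP; split.
  rewrite (ler_pdivlMr _ _ gt0).
  rewrite /g gv.
  rewrite (lp_combE _ _ Sv (ltW tv)).
  rewrite (mulf_div_cancel _ _ _ (lt0r_neq0 fv)).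
  exact: (gauge_ge _ _ hc h0 closedT x I Sv).
rewrite (ler_pdivrMr _ _ gt0).
rewrite gv0.
have := gauge_ge _ _ hc' h0' closedT x I Sv0.
rewrite (lp_combE _ _ Sv0 (ltW tv0)).
rewrite invfM mulrA (ler_pdivrMr _ _ fv0).
by move=> le1; rewrite [leRHS]mulrC.
Qed.

Let P t x := (g0 x / g t x) `^ p.

Lemma lp_factor_norm t v : sphere v -> `|t * lp_ratio v| <= `|t| * B.
Proof.
move=> Sv; rewrite normrM ler_wpM2l// gtr0_norm ?ratioB//; exact: lp_ratio_gt0.
Qed.

Lemma gauge_ratio_norm t x v0 : `|t| * B <= 2^-1 -> x != 0 -> sphere v0 ->
  g0 x = dot x v0 / h v0 ->
  exists v, [/\ sphere v, g t x = dot x v / lp_comb t v,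
    (1 + t * lp_ratio v) `^ p^-1 <= g0 x / g t x <= (1 + t * lp_ratio v0) `^ p^-1,
    `|P t x - 1| <= `|t| * B &
    `|P t x - 1 - t * lp_ratio v0| <= `|t| * `|lp_ratio v - lp_ratio v0| ].
Proof.
move=> tB x0 Sv0 gv0.
have [v [Sv gv gg]] := gauge_lp_comb_between _ _ _ tB x0 Sv0 gv0.
have tv := lp_factor_gt0 _ _ tB Sv; have tv0 := lp_factor_gt0 _ _ tB Sv0.
have tv' := lp_factor_norm t _ Sv; have tv0' := lp_factor_norm t _ Sv0.
exists v.
have [] := between_norm _ _ (P t x) _ tv' tv0' (between_powR _ _ _ _ p0 tv tv0 gg).
by rewrite -mulrBr normrM.
Qed.

Lemma argmax_near x v0 : x != 0 -> sphere v0 -> g0 x = dot x v0 / h v0 ->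
  (forall v, sphere v -> g0 x = dot x v / h v -> v = v0) ->
  forall e, 0 < e -> exists2 d, 0 < d & forall t v, `|t| * B < d ->
    `|t| * B <= 2^-1 -> sphere v -> g t x = dot x v / lp_comb t v ->
    g0 x / g t x <= (1 + t * lp_ratio v0) `^ p^-1 ->
    `|lp_ratio v - lp_ratio v0| < e.
Proof.
move=> x0 Sv0 gv0 uniq e e0.
(* A point whose gap [g0 x - dot x v / h v] is below the minimum of [m] must have [lp_ratio v]
   within [e]. Uniqueness makes that minimum positive: the gap vanishes only at [v0], where the
   second entry is [e]. *)
pose m v := Num.max (g0 x - dot x v / h v) (e - `|lp_ratio v - lp_ratio v0|).
have cm : {within sphere, continuous m}.
  apply/continuous_in_subspaceT => v /set_mem Sv.
  apply: (@continuous_max _ _ (fun v => g0 x - dot x v / h v)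
    (fun v => e - `|lp_ratio v - lp_ratio v0|)).
    apply: (@continuousB _ _ _ (fun=> g0 x) (fun v => dot x v / h v)).
      exact: cst_continuous.
    apply: (@continuousM _ _ (dot x) (fun v => (h v)^-1)); first exact: continuous_dotr.
    by apply: continuousV (hc _ Sv); rewrite gt_eqF// h0.
  apply: (@continuousB _ _ _ (fun=> e) (fun v => `|lp_ratio v - lp_ratio v0|)).
    exact: cst_continuous.
  apply: (@continuous_comp _ _ _ (fun v => lp_ratio v - lp_ratio v0) normr);
    last exact: norm_continuous.
  apply: (@continuousB _ _ _ lp_ratio (fun=> lp_ratio v0)).
    exact: lp_ratio_continuous (hc _ Sv) (kc _ Sv) (h0 _ Sv) (k0 _ Sv).
  exact: cst_continuous.
have [w /set_mem Sw mw] := compact_EVT_min (ex_intro _ _ Sv0) sphere_compact cm.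
have mw0 : 0 < m w.
  rewrite lt_max !subr_gt0; have [//|gw] := ltP (dot x w / h w) (g0 x).
  rewrite (uniq w Sw) ?subrr ?normr0//; apply/eqP; rewrite eq_le gw.
  exact: (gauge_ge _ _ hc h0 closedT x I Sw).
have gx0 : 0 < g0 x := gauge_gt0 _ hc h0 _ x0.
(* Tolerance for the factors, fitted to [near_one_gap] with the minimum [m w] as target. *)
pose eta := Num.min 2^-1 (m w / (8 * g0 x)).
have eta0 : 0 < eta by rewrite lt_min invr_gt0 ltr0n/= divr_gt0// mulr_gt0.
have eta2 : eta <= 2^-1 by rewrite ge_min lexx.
have etam : eta * (8 * g0 x) <= m w.
  by rewrite -ler_pdivlMr ?mulr_gt0// ge_min lexx orbT.
have := @continuous_powR _ p^-1 1 ltr01.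
move=> /cvgrPdist_lt/(_ _ eta0)/nbhs_ballP[d /= d0 dP].
have {}dP s : `|s| < d -> `|(1 + s) `^ p^-1 - 1| < eta.
  move=> sd; have := dP (1 + s); rewrite /ball/= powR1 [`|1 - _ `^ _|]distrC; apply.
  by rewrite opprD addrA subrr add0r normrN.
exists d => // t v td tB Sv gv gv0t.
have := dP _ (le_lt_trans (lp_factor_norm t _ Sv) td).
have := dP _ (le_lt_trans (lp_factor_norm t _ Sv0) td).
have tv := lp_factor_gt0 _ _ tB Sv; have tv0 := lp_factor_gt0 _ _ tB Sv0.
have hc' := fun v => @lp_comb_continuous t v tB.
have h0' := fun v => @lp_comb_gt0 t v tB.
have gt0 : 0 < g t x := gauge_gt0 _ hc' h0' _ x0.
rewrite (ler_pdivrMr _ _ gt0) in gv0t.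
have xv : dot x v / h v = (1 + t * lp_ratio v) `^ p^-1 * g t x.
  by rewrite gv (lp_combE _ _ Sv (ltW tv))
    (mulf_div_cancel _ _ _ (lt0r_neq0 (powR_gt0 p^-1 tv))).
move: gv0t xv; set f0 := _ `^ _; set f := _ `^ _ => gv0t xv.
move=> f01 f1; have := mw v (mem_set Sv); rewrite le_max => /orP[|vv]; last first.
  by rewrite -subr_gt0 (lt_le_trans mw0).
rewrite leNgt => /negP; case; rewrite xv.
have eta02 : 0 < eta <= 2^-1 by rewrite eta0.
exact: near_one_gap gx0 gt0 eta02 etam f1 f01 gv0t.
Qed.

(** [P t x] is the [p]-th power of the ratio of radial functions, so its power [q / p] is the ratio
    of their [q]-th powers; the coefficient [q / p] of the final formula originates here. *)
Lemma gauge_powB q t x : `|t| * B <= 2^-1 -> x != 0 ->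
  (g t x)^-1 `^ q - (g0 x)^-1 `^ q = (g0 x)^-1 `^ q * (P t x `^ (q / p) - 1).
Proof.
move=> tB x0.
have gt0 : 0 < g t x.
  by apply: gauge_gt0 x0 => v; [exact: lp_comb_continuous|exact: lp_comb_gt0].
have gx0 : 0 < g0 x := gauge_gt0 _ hc h0 _ x0.
have -> : P t x `^ (q / p) = (g0 x / g t x) `^ q.
  by rewrite /P -powRrM [p * _]mulrC divfK.
rewrite mulrBr mulr1 -powRM; last 2 first.
- by rewrite invr_ge0 (ltW gx0).
- by rewrite (divr_ge0 (ltW gx0) (ltW gt0)).
by rewrite (mulKf (lt0r_neq0 gx0)).
Qed.

Lemma gauge_pow_derivative q x v0 : x != 0 -> sphere v0 ->
  g0 x = dot x v0 / h v0 ->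
  (forall v, sphere v -> g0 x = dot x v / h v -> v = v0) ->
  ((g t x)^-1 `^ q - (g0 x)^-1 `^ q) / t @[t --> 0^'] -->
    q / p * lp_ratio v0 * (g0 x)^-1 `^ q.
Proof.
move=> x0 Sv0 gv0 uniq.
have [d [d0 dE]] := powR_slope (q / p).
have small (e : R) : 0 < e -> \forall t \near 0^', `|t| * B < e.
  move=> e0; near=> t; rewrite -ltr_pdivlMr//; near: t.
  by apply: dnbhs0_lt; rewrite divr_gt0.
have half0 : 0 < 2^-1 :> R by rewrite invr_gt0.
have tP : P t x - 1 @[t --> 0^'] --> 0.
  apply/cvgr0Pnorm_lt => e e0; near=> t.
  have tB : `|t| * B <= 2^-1 by apply: ltW; near: t; exact: small.
  have [v [_ _ _ Pt _]] := gauge_ratio_norm _ _ _ tB x0 Sv0 gv0.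
  by apply: le_lt_trans Pt _; near: t; exact: small.
have dP : (P t x - 1) / t @[t --> 0^'] --> lp_ratio v0.
  apply/cvgrPdist_lt => e e0.
  have [delta delta0 near0] := argmax_near _ _ x0 Sv0 gv0 uniq _ e0.
  near=> t.
  have tB : `|t| * B <= 2^-1 by apply: ltW; near: t; exact: small.
  have tn0 : t != 0 by near: t; exact: nbhs_dnbhs_neq.
  have [v [Sv gv /andP[_ gg] _ Pt]] := gauge_ratio_norm _ _ _ tB x0 Sv0 gv0.
  rewrite distrC -(ltr_pM2l (_ : 0 < `|t|)) ?normr_gt0// -normrM mulrBr.
  rewrite mulrCA (mulfV tn0) mulr1; apply: le_lt_trans Pt _.
  rewrite ltr_pM2l ?normr_gt0//; apply: near0 gv gg => //.
  by near: t; exact: small.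
have -> : q / p * lp_ratio v0 * (g0 x)^-1 `^ q =
  (g0 x)^-1 `^ q * (q / p * lp_ratio v0) by rewrite mulrC.
have lim : (g0 x)^-1 `^ q * (d (P t x - 1) * ((P t x - 1) / t)) @[t --> 0^']
    --> (g0 x)^-1 `^ q * (q / p * lp_ratio v0).
  apply: cvgM; first exact: cvg_cst.
  apply: cvgM => //; exact: (cvg_comp (fun t => P t x - 1) d tP d0).
apply: cvg_trans lim; apply: near_eq_cvg; near=> t.
have tB : `|t| * B <= 2^-1 by apply: ltW; near: t; exact: small.
rewrite (gauge_powB _ _ _ tB x0) -mulrA; congr (_ * _).
by rewrite mulrA -dE [1 + _]addrC subrK.
Unshelve. all: by end_near. Qed.

(** [P t x - 1] is bounded by [|t| * B] whatever [x], so one range of [t] keeps the slope function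
    within 1 of its limit [q / p] for all directions at once; this gives the constant (|q/p| + 1)
    B. *)
Lemma gauge_pow_lipschitz q : exists C d, [/\ 0 <= C, 0 < d & forall t x,
  `|t| < d -> t != 0 -> x != 0 ->
  `| ((g t x)^-1 `^ q - (g0 x)^-1 `^ q) / t | <= C * (g0 x)^-1 `^ q].
Proof.
have [d [d0 dE]] := powR_slope (q / p).
have /cvgrPdist_lt/(_ _ ltr01)/nbhs_ballP[e /= e0 de] := d0.
have {}de s : `|s| < e -> `|d s| <= `|q / p| + 1.
  move=> se; have /de : ball 0 e s by rewrite /ball/= sub0r normrN.
  rewrite distrC => dqp; rewrite -lerBlDl; apply: le_trans (ltW dqp).
  exact: lerB_dist.
exists ((`|q / p| + 1) * B), (Num.min 2^-1 e / B); split.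
- by rewrite mulr_ge0 ?(ltW B0)// addr_ge0.
- by rewrite divr_gt0// lt_min invr_gt0 ltr0n e0.
move=> t x; rewrite ltr_pdivlMr// lt_min => /andP[/ltW tB te] t0 x0.
have [v0 [_ Sv0 gv0]] :=
  gauge_attained _ setT hc h0 closedT (sphere_neq_set0 _ x0) x.
have [v [_ _ _ Pt _]] := gauge_ratio_norm _ _ _ tB x0 Sv0 gv0.
rewrite (gauge_powB _ _ _ tB x0) normrM normfV ler_pdivrMr ?normr_gt0// normrM.
rewrite ger0_norm ?powR_ge0// -[X in X <= _]mulrC [leRHS]mulrAC.
rewrite ler_wpM2r ?powR_ge0//.
have -> : P t x `^ (q / p) - 1 = d (P t x - 1) * (P t x - 1).
  by rewrite -dE; congr (_ `^ _ - _); rewrite addrC subrK.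
rewrite normrM -mulrA ler_pM// ?de ?(le_lt_trans Pt)//.
by rewrite mulrC.
Qed.

End Perturbation.

(** * Image measures with density *)

Section Density.
Local Open Scope ereal_scope.
Context {d1 d2 : measure_display} {X : measurableType d1} {Y : measurableType d2}
  {R : realType}.
Variables (lam : {measure set X -> \bar R}) (mu : {measure set Y -> \bar R}).

Import HBNNSimple.

(** The integral is a supremum over simple functions below the extension of [f] by zero, which can
    only grow with the domain, measurable or not. Reverse radial Gauss images call for this
    generality. *)
Lemma ge0_subset_integral_nonmeasurable (A B : set X) (f : X -> \bar R) :
  (forall x, B x -> 0 <= f x) -> A `<=` B ->
  \int[lam]_(x in A) f x <= \int[lam]_(x in B) f x.
Proof.
move=> f0 AB; rewrite !ge0_integralE//=; last by move=> x /AB /f0.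
apply: ge_ereal_sup => _ [h /= hf <-].
apply: ereal_sup_ubound; exists h => //= x.
apply: le_trans (hf x) _; rewrite /patch.
have [/set_mem xA|_] := boolP (x \in A); first by rewrite mem_set//; exact: AB.
by case: ifPn => // /set_mem/f0.
Qed.

(* The integral of a nonnegative function over a non-measurable set is an inner
   one, so it agrees with that over any measurable set differing by a null set. *)
Lemma integral_null_diff (A B Z D : set X) (f : X -> \bar R) :
  measurable D -> measurable B -> measurable Z -> B `<=` D -> A `<=` D ->
  measurable_fun D f -> (forall x, D x -> 0 <= f x) -> lam Z = 0 ->
  A `\` Z `<=` B -> B `\` Z `<=` A ->
  \int[lam]_(x in A) f x = \int[lam]_(x in B) f x.
Proof.
move=> mD mB mZ BD AD mf f0 Z0 AB BA; apply/eqP; rewrite eq_le; apply/andP; split.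
  (* [Z] is cut down to [D], outside which nothing is assumed about [f]. *)
  have mBZ : measurable (B `|` (Z `&` D)).
    by apply: measurableU => //; exact: measurableI.
  have BZD : B `|` (Z `&` D) `<=` D by move=> x [/BD//|[]].
  apply: (@le_trans _ _ (\int[lam]_(x in B `|` (Z `&` D)) f x)).
    apply: ge0_subset_integral_nonmeasurable => [x /BZD/f0//|x Ax].
    by have [Zx|Zx] := pselect (Z x); [right; split => //; exact: AD|left; exact: AB].
  rewrite (@ge0_negligible_integral _ _ _ _ _ Z)//; last 2 first.
  - exact: measurable_funS mf.
  - by move=> x /BZD/f0.
  apply: ge0_subset_integral_nonmeasurable => [x /BD/f0//|x [[//|[Zx _]] /(_ Zx)]].
  by [].
rewrite (@ge0_negligible_integral _ _ _ _ _ Z)//; last 2 first.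
- exact: measurable_funS mf.
- by move=> x /BD/f0.
by apply: ge0_subset_integral_nonmeasurable => // x /AD/f0.
Qed.

Lemma integral_eq0_measure0 (A : set X) (f : X -> \bar R) :
  measurable A -> measurable_fun A f -> (forall x, A x -> 0 < f x) ->
  \int[lam]_(x in A) f x = 0 -> lam A = 0.
Proof.
move=> mA mf f0 If0.
have /(ae_eq_integral_abs _ mA mf) [N [mN N0 AN]] :
    \int[lam]_(x in A) `|f x| = 0.
  by rewrite -[RHS]If0; apply: eq_integral => x /set_mem/f0/ltW/gee0_abs.
apply: (subset_measure0 mA mN _ N0) => x Ax; apply: AN => /= /(_ Ax) fx.
by have := f0 _ Ax; rewrite fx ltxx.
Qed.

Variables (E : set X) (S : set Y) (a : X -> Y) (w : X -> R).
Hypothesis mE : measurable E.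
Hypothesis mS : measurable S.
Hypothesis ma : measurable_fun E a.
Hypothesis mw : measurable_fun E w.
Hypothesis w0 : forall x, E x -> (0 <= w x)%R.
Hypothesis aS : forall x, E x -> S (a x).
Hypothesis muE : forall eta, measurable eta ->
  mu eta = \int[lam]_(x in E `&` a @^-1` eta) (w x)%:E.

Let integral_image_nnsfun (h : {nnsfun Y >-> R}) :
  \int[mu]_(y in S) (h y)%:E = \int[lam]_(x in E) ((h (a x))%:E * (w x)%:E).
Proof.
have mEh k : measurable (E `&` a @^-1` (h @^-1` [set k])) by exact: ma.
transitivity (\sum_(k \in range h) k%:E * mu (h @^-1` [set k])).
  under eq_integral do rewrite fimfunE -fsumEFin//.
  rewrite ge0_integral_fsum//; last 2 first.
  - by move=> y; exact/measurable_EFinP/measurable_funM.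
  - by move=> y x _; rewrite nnfun_muleindic_ge0.
  apply: eq_fsbigr => r _; rewrite integralZl_indic_nnsfun// integral_indic//=.
  congr (_ * _); rewrite !muE//; last exact: measurableI.
  congr (integral _ _ _); apply/seteqP; split => x /=; first by move=> [? []].
  by move=> [Ex hx]; split => //; split => //; exact: aS.
transitivity (\sum_(k \in range h)
    \int[lam]_(x in E) ((k * \1_(h @^-1` [set k]) (a x))%:E * (w x)%:E)).
  apply: eq_fsbigr => k /set_mem[y _ hk].
  have k0 : (0 <= k)%R by rewrite -hk.
  rewrite muE// -{1}(setIid E) -setIA integral_mkcondr -ge0_integralZl_EFin//; last 2 first.
  - by move=> x Ex; rewrite patchE; case: ifPn => // _; rewrite lee_fin w0.
  - apply/(measurable_restrict _ (mEh k) mE)/measurable_EFinP.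
    by apply: measurable_funS mw => // x [].
  apply: eq_integral => x /set_mem Ex; rewrite EFinM -muleA; congr (_ * _).
  rewrite patchE indicE.
  have -> : (x \in E `&` a @^-1` (h @^-1` [set k])) = (a x \in h @^-1` [set k]).
    by apply/idP/idP => /set_mem; [move=> [_ ?]|move=> ?]; exact/mem_set.
  by case: ifPn; rewrite ?mul1e ?mul0e.
rewrite -ge0_integral_fsum//.
- apply: eq_integral => x _; rewrite [in RHS]fimfunE -fsumEFin// ge0_mule_fsuml//.
  by move=> r; rewrite nnfun_muleindic_ge0.
- move=> r; apply: emeasurable_funM; apply/measurable_EFinP => //.
  by apply: measurable_funM => //; apply: measurableT_comp ma.
- by move=> r x Ex; rewrite mule_ge0 ?nnfun_muleindic_ge0// lee_fin w0.
Qed.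

(** [mu] is the image under [a] of the measure with density [w] on [E]: linearity gives the identity
    for simple functions, monotone convergence for [f]. With [a] the radial Gauss map this is the
    change of variables. *)
Lemma ge0_integral_image_density (f : Y -> \bar R) :
  measurable_fun S f -> (forall y, S y -> 0 <= f y) ->
  \int[mu]_(y in S) f y = \int[lam]_(x in E) (f (a x) * (w x)%:E).
Proof.
move=> mf f0; pose f_ := nnsfun_approx mS mf.
have mfa n : measurable_fun E (fun x => (f_ n (a x))%:E).
  by apply/measurable_EFinP; apply: measurableT_comp.
transitivity (limn (fun n => \int[mu]_(y in S) (f_ n y)%:E)).
  rewrite -monotone_convergence//.
  - apply: eq_integral => y /set_mem Sy; apply/esym/cvg_lim => //.
    exact: cvg_nnsfun_approx.
  - by move=> n; exact/measurable_EFinP/measurable_funP.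
  - by move=> n y _; rewrite lee_fin.
  - by move=> y _ m n mn; rewrite lee_fin; exact/lefP/nd_nnsfun_approx.
under eq_fun do rewrite integral_image_nnsfun.
rewrite -monotone_convergence//.
- apply: eq_integral => x /set_mem Ex; apply/cvg_lim => //.
  apply: cvgeZr => //; apply: cvg_nnsfun_approx => //; exact: aS.
- by move=> n; apply: emeasurable_funM => //; exact/measurable_EFinP.
- by move=> n x Ex; rewrite mule_ge0// lee_fin ?w0.
- move=> x Ex m n mn; rewrite lee_wpmul2r// ?lee_fin ?w0//.
  exact/lefP/nd_nnsfun_approx.
Qed.

End Density.

(** * Borel sets of n.-tuple R and of 'rV[R]_n *)

Section TupleBorel.
Context {R : realType} {n : nat}.
Local Notation V := 'rV[R]_n.

(** Balls of the maximum norm are boxes, and an open set is the countable union of the balls with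
    rational centre and radius that it contains. *)
Lemma measurable_tup2rv_open (U : set V) : open U -> measurable (tup2rv @^-1` U).
Proof.
move=> oU.
pose F (i : 'rV[rat]_n * rat) : set (n.-tuple R) :=
  if `[< ball (map_mx ratr i.1 : V) (ratr i.2) `<=` U >]
  then tup2rv @^-1` (ball (map_mx ratr i.1 : V) (ratr i.2)) else set0.
have -> : tup2rv @^-1` U = \bigcup_i F i.
  apply/seteqP; split => [t Ut|t [i _]]; last first.
    by rewrite /F; case: asboolP => // iU /iU.
  have /nbhs_ballP[e /= e0 eU] : nbhs (tup2rv t) U by exact: open_nbhs_nbhs.
  have e2 : 0 < e / 2 by rewrite divr_gt0.
  have [r] := rat_in_itvoo e2.
  rewrite in_itv/= => /andP[r0 re].
  have near_rat (x : R) : exists q : rat, `|ratr q - x| < ratr r.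
    have xx : x - ratr r < x + ratr r by lra.
    have [q] := rat_in_itvoo xx.
    by rewrite in_itv/= => /andP[? ?]; exists q; rewrite ltr_norml; lra.
  have [c cP] := choice near_rat.
  pose q : 'rV[rat]_n := \row_i c (tnth t i).
  have qt : ball (map_mx ratr q : V) (ratr r) (tup2rv t).
    by split => // i k; rewrite !mxE; exact: cP.
  exists (q, r) => //; rewrite /F/=; case: asboolP => //; case => x qx.
  apply: eU; rewrite (splitr e).
  have tq : ball (tup2rv t) (e / 2) (map_mx ratr q).
    by apply: ball_sym; apply: le_ball qt; exact: ltW.
  have qx' : ball (map_mx ratr q : V) (e / 2) x by apply: le_ball qx; exact: ltW.
  exact: ball_triangle tq qx'.
apply: countable_bigcupT_measurable => [|i]; first exact: countableP.
rewrite /F; case: asboolP => // _.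
have [r0|r0] := ltP 0 (ratr i.2 : R); last first.
  rewrite (_ : _ @^-1` _ = set0)//; apply/seteqP; split => // t [].
  by rewrite ltNge r0.
rewrite (_ : _ @^-1` _ = \bigcap_(k in [set: 'I_n])
    ((fun t : n.-tuple R => tnth t k) @^-1`
      (ball (ratr (i.1 ord0 k) : R) (ratr i.2)))); last first.
  apply/seteqP; split => [t [_ h] k _|t h]; first by have := h ord0 k; rewrite !mxE.
  by split => // l k; rewrite !mxE ord1; exact: (h k).
apply: fin_bigcap_measurable => // k _.
rewrite -[X in measurable X]setTI; apply: measurable_tnth => //.
exact: measurable_ball.
Qed.

Lemma measurable_tup2rv_closed (A : set V) : closed A -> measurable (tup2rv @^-1` A).
Proof.
move=> cA; rewrite -[A]setCK preimage_setC; apply: measurableC.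
exact: measurable_tup2rv_open (closed_openC cA).
Qed.

Lemma measurable_fun_tup2rv (O : set V) (D : set (n.-tuple R)) (f : V -> R) :
  open O -> D `<=` tup2rv @^-1` O ->
  (forall x, O x -> {for x, continuous f}) ->
  measurable_fun D (f \o tup2rv).
Proof.
move=> oO DO cf.
apply: (@measurable_funS _ _ _ _ (tup2rv @^-1` O)) => //.
  exact: measurable_tup2rv_open oO.
apply: (measurability (@RGenOInfty.G R)); first exact: RGenOInfty.measurableE.
move=> _ [_ [r ->] <-].
rewrite (_ : _ `&` _ = tup2rv @^-1` (O `&` f @^-1` `]r, +oo[)); last first.
  by apply/seteqP; split.
apply: measurable_tup2rv_open.
have -> : O `&` f @^-1` `]r, +oo[ = (O `&` f @^-1` `]r, +oo[)^°; last exact: open_interior.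
apply/seteqP; split; last exact: interior_subset.
move=> x [Ox fx]; apply: filterI; first exact: open_nbhs_nbhs.
by apply: (cf x Ox); apply: open_nbhs_nbhs; split.
Qed.

Lemma lebesgue_ball_lty (lam : {measure set (n.-tuple R) -> \bar R}) (D : set (n.-tuple R)) :
  is_lebesgue lam -> measurable D -> (forall t, D t -> enorm (tup2rv t) <= 1) ->
  (lam D < +oo)%E.
Proof.
move=> lamL mD D1.
have D2 (i : 'I_n) t : D t -> - 1 <= tnth t i <= 1.
  move=> /D1; rewrite -(@expr_le1 _ 2) ?sqrtr_ge0// sqr_sqrtr ?dot_ge0// => t1.
  rewrite -ler_norml -(@expr_le1 _ 2)// real_normK ?num_real//; apply: le_trans t1.
  rewrite /dot (bigD1 i)//= !mxE -expr2 lerDl.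
  by apply: sumr_ge0 => k _; rewrite -expr2 sqr_ge0.
(* The corner is -2 because the boxes of [is_lebesgue] are open on the left and the coordinate value
   -1 must be included. *)
pose a : n.-tuple R := [tuple of nseq n (- 2)].
pose b : n.-tuple R := [tuple of nseq n 1].
have aE i : tnth a i = - 2 by rewrite (tnth_nth 0)/= nth_nseq ltn_ord.
have bE i : tnth b i = 1 by rewrite (tnth_nth 0)/= nth_nseq ltn_ord.
have Dab : D `<=` [set t | forall i, tnth a i < tnth t i <= tnth b i].
  by move=> t Dt i /=; rewrite aE bE; have := D2 i t Dt; lra.
apply: (@le_lt_trans _ _ (lam [set t | forall i, tnth a i < tnth t i <= tnth b i])).
  apply: le_measure; rewrite ?inE//.
  rewrite (_ : [set _ | _] = \bigcap_(k in [set: 'I_n])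
    ((fun t : n.-tuple R => tnth t k) @^-1` `]tnth a k, tnth b k])); last first.
    by apply/seteqP; split => t /= h; [move=> k _; rewrite /= in_itv/=; exact: h|
      move=> k; have := h k I; rewrite /= in_itv/=].
  apply: fin_bigcap_measurable => // k _.
  rewrite -[X in measurable X]setTI; apply: measurable_tnth => //.
rewrite lamL ?ltry// => i; rewrite aE bE; lra.
Qed.

End TupleBorel.

(** * Contact directions and uniqueness of normals *)

Section PuncturedBall.
Context {R : realType} {n : nat}.
Local Notation V := 'rV[R]_n.

Definition punctured_ball : set (n.-tuple R) := [set t | 0 < enorm (tup2rv t) <= 1].

Definition direction (t : n.-tuple R) : V := normalize (tup2rv t).

Definition rv2tup (v : V) : n.-tuple R := [tuple v ord0 i | i < n].

Lemma rv2tupK : cancel rv2tup tup2rv.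
Proof. by move=> v; apply/rowP => i; rewrite mxE tnth_mktuple. Qed.

Lemma tup2rvK : cancel (@tup2rv R n) rv2tup.
Proof. by move=> t; apply/eq_from_tnth => i; rewrite tnth_mktuple mxE. Qed.

Lemma tup2rv_preimageK (A : set V) : tup2rv @` (tup2rv @^-1` A) = A.
Proof.
apply/seteqP; split => [_ [t At <-]//|v Av].
by exists (rv2tup v); rewrite /= ?rv2tupK.
Qed.

Lemma punctured_ball_neq0 t : punctured_ball t -> tup2rv t != 0.
Proof. by move=> /andP[+ _]; rewrite enorm_gt0. Qed.

Lemma direction_sphere t : punctured_ball t -> sphere (direction t).
Proof. by move=> /punctured_ball_neq0; exact: normalize_sphere. Qed.

Lemma direction_neq0 t : punctured_ball t -> direction t != 0.
Proof. by move=> /direction_sphere; exact: sphere_neq0. Qed.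

Lemma open_neq0 : open [set x : V | x != 0].
Proof.
have -> : [set x : V | x != 0] = ~` (@enorm R n @^-1` [set y : R | y <= 0]).
  by apply/seteqP; split => x /=; rewrite -enorm_gt0 ltNge; move/negP.
apply: closed_openC.
exact: (iffLR (continuous_closedP _) (@continuous_enorm R n) _ (@closed_le _ 0)).
Qed.

Lemma measurable_punctured_ball : measurable punctured_ball.
Proof.
have -> : punctured_ball = tup2rv @^-1` [set x | x != 0] `&`
    tup2rv @^-1` [set x : V | enorm x <= 1].
  by apply/seteqP; split => t; rewrite /punctured_ball/= enorm_gt0 => /andP.
apply: measurableI; first exact: measurable_tup2rv_open open_neq0.
apply: measurable_tup2rv_closed.
exact: (iffLR (continuous_closedP _) (@continuous_enorm R n) _ (@closed_le _ 1)).
Qed.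

Lemma punctured_ball_lty (lam : {measure set (n.-tuple R) -> \bar R}) :
  is_lebesgue lam -> (lam punctured_ball < +oo)%E.
Proof.
move=> lamL; apply: lebesgue_ball_lty lamL measurable_punctured_ball _.
by move=> t /andP[].
Qed.

Section homogeneous.
Variable f : V -> R.
Hypothesis cf : forall u, u != 0 -> {for u, continuous f}.

Lemma measurable_fun_direction (D : set (n.-tuple R)) : D `<=` punctured_ball ->
  measurable_fun D (f \o direction).
Proof.
move=> Dball; apply: (@measurable_fun_tup2rv _ _ _ _ (f \o @normalize R n) open_neq0).
  by move=> t /Dball/punctured_ball_neq0.
move=> x /= x0; apply: continuous_comp; first exact: continuous_normalize.
by apply: cf; apply: sphere_neq0; exact: normalize_sphere.
Qed.

Lemma bounded_direction : exists C, forall t, punctured_ball t -> `|f (direction t)| <= C.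
Proof.
have : compact (f @` sphere).
  apply: continuous_compact sphere_compact.
  by apply/continuous_in_subspaceT => v /set_mem/sphere_neq0; exact: cf.
move=> /compact_bounded[C [_ CB]]; exists (`|C| + 1) => t Dt.
apply: CB; first by rewrite (le_lt_trans (ler_norm _))// ltrDl.
by exists (direction t) => //; exact: direction_sphere.
Qed.

Lemma integrable_direction (lam : {measure set (n.-tuple R) -> \bar R})
    (D : set (n.-tuple R)) : is_lebesgue lam -> measurable D ->
  D `<=` punctured_ball -> lam.-integrable D (EFin \o (f \o direction)).
Proof.
move=> lamL mD Dball; apply: measurable_bounded_integrable => //.
- apply: le_lt_trans (punctured_ball_lty _ lamL).
  by apply: le_measure; rewrite ?inE//; exact: measurable_punctured_ball.
- exact: measurable_fun_direction.
have [C fC] := bounded_direction.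
exists C; split; first exact: num_real.
by move=> r Cr t Dt; apply: le_trans (fC _ (Dball _ Dt)) (ltW Cr).
Qed.

End homogeneous.
End PuncturedBall.

(** * Directions having a normal in a given set *)

Section Contact.
Context {R : realType} {n : nat}.
Local Notation V := 'rV[R]_n.
Variable h : V -> R.
Hypothesis hc : forall v, sphere v -> {for v, continuous h}.
Hypothesis h0 : forall v, sphere v -> 0 < h v.

(** For [h = hsupp M] and nonzero [u], [v] is an outer unit normal of [M] at its boundary point in
    direction [u]; [contact A] is then the truncated cone over the reverse radial Gauss image of
    [A]. *)
Definition contact_normal (u v : V) := sphere v /\ gauge h setT u = dot u v / h v.

Definition contact (A : set V) : set (n.-tuple R) :=
  [set t | punctured_ball t /\ exists2 v, A v & contact_normal (direction t) v].

Lemma contact_normal_ex u : u != 0 -> exists v, contact_normal u v.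
Proof.
move=> u0.
have [v [_ Sv gv]] :=
  gauge_attained _ setT hc h0 closedT (sphere_neq_set0 _ u0) u.
by exists v.
Qed.

(** A normal in [A] exists exactly when the maximum over [A] reaches the maximum over the whole
    sphere. Both are continuous in the direction, and closedness of [A] makes the former
    attained. *)
Lemma measurable_contact A : closed A -> measurable (contact A).
Proof.
move=> cA; have [A0|A0] := pselect (A `&` sphere !=set0); last first.
  rewrite (_ : contact A = set0)//; apply/seteqP; split => // t [_ [v Av [Sv _]]].
  by apply: A0; exists v.
have T0 : setT `&` @sphere R n !=set0 by case: A0 => v [_ Sv]; exists v.
have -> : contact A = punctured_ball `&`
    [set t | (gauge h setT \o direction) t <= (gauge h A \o direction) t].
  apply/seteqP; split => t [Dt] /=.
    by move=> [v Av [Sv ->]]; split => //; exact: gauge_ge.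
  move=> tA; split => //.
  have [v [Av Sv gv]] := gauge_attained _ _ hc h0 cA A0 (direction t).
  exists v => //; split => //; apply/eqP; rewrite eq_le -{1}gv tA/=.
  exact: (gauge_ge _ _ hc h0 closedT _ I Sv).
apply: measurable_fun_le; first exact: measurable_punctured_ball.
  apply: measurable_fun_direction => // u _.
  exact: (continuous_gauge _ _ hc h0 closedT T0).
apply: measurable_fun_direction => // u _.
exact: (continuous_gauge _ _ hc h0 cA A0).
Qed.

Lemma contactU A B : contact (A `|` B) = contact A `|` contact B.
Proof.
apply/seteqP; split => t.
  by move=> [Dt [v [Av|Bv] cv]]; [left|right]; split => //; exists v.
by move=> [[Dt [v Av cv]]|[Dt [v Bv cv]]]; split => //; exists v => //; [left|right].
Qed.

Variables (lam mu : {measure set (n.-tuple R) -> \bar R}).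
Variable w : n.-tuple R -> R.
Hypothesis mw : measurable_fun punctured_ball w.
Hypothesis w0 : forall t, punctured_ball t -> 0 < w t.
Hypothesis iw : (\int[lam]_(t in punctured_ball) (w t)%:E < +oo)%E.
Hypothesis muE : forall eta, measurable eta ->
  mu eta = (\int[lam]_(t in contact (tup2rv @` eta)) (w t)%:E)%E.

Let contact_sub A : contact A `<=` punctured_ball. Proof. by move=> t []. Qed.

(* The only place where almost everywhere differentiability of the gauge is
   needed; here it follows from the additivity of [mu]. *)
Lemma contact_disjoint_null A B : closed A -> closed B -> A `&` B = set0 ->
  lam (contact A `&` contact B) = 0%E.
Proof.
move=> cA cB AB.
have mA := measurable_contact _ cA; have mB := measurable_contact _ cB.
have mAB : measurable (contact A `&` contact B) by exact: measurableI.
have mwD D : measurable D -> D `<=` punctured_ball ->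
    measurable_fun D (fun t => (w t)%:E).
  by move=> mD Dball; apply/measurable_EFinP; apply: measurable_funS mw;
    first exact: measurable_punctured_ball.
have wge0 D t : D `<=` punctured_ball -> D t -> (0 <= (w t)%:E)%E.
  by move=> Dball /Dball/w0/ltW; rewrite lee_fin.
have fin D : measurable D -> D `<=` punctured_ball ->
    (\int[lam]_(t in D) (w t)%:E)%E \is a fin_num.
  move=> mD Dball; rewrite ge0_fin_numE; last by apply: integral_ge0 => t /wge0; exact.
  apply: le_lt_trans iw; apply: ge0_subset_integral_nonmeasurable => // t.
  exact: wge0.
apply: (@integral_eq0_measure0 _ _ _ _ _ (fun t => (w t)%:E)) => //.
- by apply: mwD => // t [/contact_sub].
- by move=> t [/contact_sub/w0]; rewrite lte_fin.
have mtA := measurable_tup2rv_closed _ cA; have mtB := measurable_tup2rv_closed _ cB.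
have : mu (tup2rv @^-1` A `|` tup2rv @^-1` B) =
    (mu (tup2rv @^-1` A) + mu (tup2rv @^-1` B))%E.
  by apply: measureU => //; rewrite -preimage_setI AB preimage_set0.
rewrite !muE//; last exact: measurableU.
rewrite -preimage_setU !tup2rv_preimageK contactU.
set CA := contact A in mA mAB *; set CB := contact B in mB mAB *.
have -> : CA `|` CB = (CA `\` CB) `|` CB.
  by rewrite setDE setUIl (setUC (~` CB)) setUv setIT.
rewrite [in X in _ = (X + _)%E -> _](_ : CA = (CA `\` CB) `|` (CA `&` CB)); last first.
  by rewrite setUC setUIDK.
have mD : measurable (CA `\` CB) by exact: measurableD.
have subD : CA `\` CB `<=` punctured_ball by move=> t [/contact_sub].
have subI : CA `&` CB `<=` punctured_ball by move=> t [/contact_sub].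
have splitI (X Y : set (n.-tuple R)) : measurable X -> measurable Y ->
    X `<=` punctured_ball -> Y `<=` punctured_ball -> X `&` Y = set0 ->
    (\int[lam]_(t in X `|` Y) (w t)%:E =
      \int[lam]_(t in X) (w t)%:E + \int[lam]_(t in Y) (w t)%:E)%E.
  move=> mX mY XD YD XY0.
  have XYD : X `|` Y `<=` punctured_ball by move=> t [/XD|/YD].
  apply: ge0_integral_setU => //; [|by move=> t; exact: wge0|by rewrite disj_set2E XY0].
  by apply: mwD => //; exact: measurableU.
rewrite (splitI _ _ mD mB subD (@contact_sub B)); last by rewrite setDE -setIA setICl setI0.
rewrite (splitI _ _ mD mAB subD subI); last first.
  by rewrite setDE -setIA (setIC (~` CB)) -setIA setICr !setI0.
(* All three integrals are finite, so the terms common to both sides cancel and the integral over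
   the overlap is zero. *)
have := fin _ mD subD; have := fin _ mAB subI; have := fin _ mB (@contact_sub B).
move=> /fineK <- /fineK <- /fineK <-; rewrite -!EFinD => -[].
rewrite -addrA => /addrI/eqP; rewrite -[X in X == _]add0r (inj_eq (addIr _)).
by rewrite eq_sym => /eqP ->.
Qed.

(** Using two rationals rather than one makes the half-spaces both closed and disjoint, as
    [contact_disjoint_null] requires. *)
Let slab (k : 'I_n * rat * rat) : set (n.-tuple R) :=
  if k.1.2 < k.2 then
    contact [set v | v ord0 k.1.1 <= ratr k.1.2] `&`
    contact [set v | ratr k.2 <= v ord0 k.1.1]
  else set0.

(** Two distinct normals differ in a coordinate and are separated there by two rationals, so this
    countable union captures every direction with several normals. *)
Definition multinormal : set (n.-tuple R) :=
  \bigcup_m (if unpickle m is Some k then slab k else set0).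

Let coord_le_closed i (r : R) : closed [set v : V | v ord0 i <= r].
Proof.
exact: (iffLR (continuous_closedP _) (@coord_continuous R 1 n ord0 i) _ (@closed_le _ r)).
Qed.

Let coord_ge_closed i (r : R) : closed [set v : V | r <= v ord0 i].
Proof.
exact: (iffLR (continuous_closedP _) (@coord_continuous R 1 n ord0 i) _ (@closed_ge _ r)).
Qed.

Lemma measurable_multinormal : measurable multinormal.
Proof.
apply: bigcupT_measurable => m; case: unpickle => // k.
rewrite /slab; case: ifP => // _.
by apply: measurableI; apply: measurable_contact;
    solve [exact: coord_le_closed|exact: coord_ge_closed].
Qed.

Lemma multinormal_null : lam multinormal = 0%E.
Proof.
apply: measure_negligible; first exact: measurable_multinormal.
apply: negligible_bigcup => m; case: unpickle => [k|]; last exact: negligible_set0.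
rewrite /slab; case: ifPn => [kk|_]; last exact: negligible_set0.
apply/negligibleP; first by apply: measurableI; apply: measurable_contact;
    solve [exact: coord_le_closed|exact: coord_ge_closed].
apply: contact_disjoint_null; [exact: coord_le_closed|exact: coord_ge_closed|].
apply/seteqP; split => // v [/= vk kv].
by have := le_trans kv vk; rewrite ler_rat leNgt kk.
Qed.

Lemma contact_normal_unique t u v : punctured_ball t -> ~ multinormal t ->
  contact_normal (direction t) u -> contact_normal (direction t) v -> u = v.
Proof.
move=> Dt Zt; suff le_coord x y : contact_normal (direction t) x ->
    contact_normal (direction t) y -> forall i, x ord0 i <= y ord0 i.
  by move=> cu cv; apply/rowP => i; apply/eqP; rewrite eq_le !le_coord.
move=> cx cy i; rewrite leNgt; apply/negP => yx; apply: Zt.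
have [r' ] := rat_in_itvoo yx; rewrite in_itv/= => /andP[yr' r'x].
have [r ] := rat_in_itvoo yr'; rewrite in_itv/= => /andP[yr rr'].
exists (pickle (i, r, r')) => //; rewrite pickleK /slab/=.
rewrite -(ltr_rat R) rr'; split; split => //.
  by exists y => //=; exact: ltW.
by exists x => //=; exact: ltW.
Qed.

Definition regular_ball : set (n.-tuple R) := punctured_ball `\` multinormal.

Lemma measurable_regular_ball : measurable regular_ball.
Proof.
by apply: measurableD; [exact: measurable_punctured_ball|exact: measurable_multinormal].
Qed.

(** Agrees with the radial Gauss map on [regular_ball]; on the null set [multinormal] it picks an
    arbitrary normal. *)
Definition radial_gauss (t : n.-tuple R) : V := xget 0 (contact_normal (direction t)).

Lemma radial_gaussP t : punctured_ball t -> contact_normal (direction t) (radial_gauss t).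
Proof.
move=> /direction_neq0/contact_normal_ex[v cv].
exact: (@xgetPex _ 0 (contact_normal (direction t)) (ex_intro _ v cv)).
Qed.

(** Where the normal is unique, its coordinate [i] is at least [r] exactly when the direction has a
    normal in the closed half-space so described; preimages of half-lines are thus contact sets. *)
Lemma measurable_radial_gauss : measurable_fun regular_ball (rv2tup \o radial_gauss).
Proof.
have mcoord i : measurable_fun regular_ball (fun t => radial_gauss t ord0 i).
  apply: (measurability (@RGenCInfty.G R)); first exact: RGenCInfty.measurableE.
  move=> _ [_ [r ->] <-].
  have -> : regular_ball `&` (fun t => radial_gauss t ord0 i) @^-1` `[r, +oo[ =
      regular_ball `&` contact [set v | r <= v ord0 i].
    apply/seteqP; split => t [Et] /=; rewrite in_itv/= andbT.
      by move=> rt; split => //; split; [case: Et|exists (radial_gauss t) => //;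
        apply: radial_gaussP; case: Et].
    move=> [Dt [v /= rv cv]]; split => //.
    have [_ Zt] := Et.
    by rewrite (contact_normal_unique _ _ _ Dt Zt (radial_gaussP _ Dt) cv).
  by apply: measurableI; [exact: measurable_regular_ball|
    exact: measurable_contact (coord_ge_closed _ _)].
apply: (measurability (\big[setU/set0]_(i < n)
  preimage_set_system setT ((@tnth n R)^~ i) measurable)) => //.
move=> _ [X + <-]; rewrite -bigcup_seq => -[i /= _ [Y mY <-]].
rewrite setTI -comp_preimage.
have -> : (@tnth n R)^~ i \o (rv2tup \o radial_gauss) = fun t => radial_gauss t ord0 i.
  by apply/funext => t; rewrite /= tnth_mktuple.
exact: mcoord measurable_regular_ball _ mY.
Qed.

Lemma integral_radial_gauss (f : n.-tuple R -> \bar R) :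
  measurable_fun (tup2rv @^-1` sphere) f ->
  (forall y, sphere (tup2rv y) -> (0 <= f y)%E) ->
  (\int[mu]_(y in tup2rv @^-1` sphere) f y =
   \int[lam]_(t in regular_ball) (f (rv2tup (radial_gauss t)) * (w t)%:E))%E.
Proof.
move=> mf f0; apply: ge0_integral_image_density => //.
- exact: measurable_regular_ball.
- by apply: measurable_tup2rv_closed; exact: compact_closed sphere_compact.
- exact: measurable_radial_gauss.
- apply: measurable_funS mw; first exact: measurable_punctured_ball.
  exact: subDsetl.
- by move=> t [/w0/ltW].
- by move=> t [/radial_gaussP[St _] _]; rewrite /= rv2tupK.
move=> eta meta; rewrite muE//.
(* The contact set of a Borel [eta] is not known to be measurable, but off [multinormal] it
   coincides with the preimage of [eta] under the radial Gauss map. *)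
apply: (@integral_null_diff _ _ _ _ _ _ multinormal punctured_ball).
- exact: measurable_punctured_ball.
- exact: measurable_radial_gauss measurable_regular_ball _ meta.
- exact: measurable_multinormal.
- by move=> t [[]].
- exact: contact_sub.
- exact/measurable_EFinP.
- by move=> t /w0/ltW; rewrite lee_fin.
- exact: multinormal_null.
- move=> t [[Dt [v [s es sv] cv]] Zt]; split => //=.
  by rewrite -(contact_normal_unique _ _ _ Dt Zt cv (radial_gaussP _ Dt)) -sv tup2rvK.
move=> t [[[Dt _] /= et] _]; split => //; exists (radial_gauss t).
  by exists (rv2tup (radial_gauss t)) => //; exact: rv2tupK.
exact: radial_gaussP.
Qed.

End Contact.

(** * The variational formula *)

Section Quermass.
Context {R : realType} {n : nat}.
Local Notation V := 'rV[R]_n.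
Variable lam : {measure set (n.-tuple R) -> \bar R}.
Hypothesis lamL : is_lebesgue lam.

Lemma star_body_radial (Q : set V) : star_body_o Q ->
  (forall u, u != 0 -> 0 < radial Q u) /\
  (forall u, u != 0 -> {for u, continuous (radial Q)}).
Proof.
move=> [_ [_ [Q0 cQ]]]; split => // u u0.
have oC : open (~` [set 0 : V]).
  rewrite (_ : ~` _ = [set x : V | x != 0]); first exact: open_neq0.
  by apply/seteqP; split => x /= /eqP.
move: cQ; rewrite continuous_open_subspace// => cQ; apply: cQ.
by rewrite inE /=; exact/eqP.
Qed.

Lemma sphere_dim_gt0 : @sphere R n !=set0 -> (0 < n)%N.
Proof.
case=> v /sphereE; rewrite /dot; case: (n) v => // v.
by rewrite big_ord0 => /eqP; rewrite eq_sym oner_eq0.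
Qed.

Lemma sph_int_sphere (f g : V -> R) : (forall u, sphere u -> f u = g u) ->
  sph_int lam sphere f =
  (n%:R%:E * \int[lam]_(t in punctured_ball) (g (direction t))%:E)%E.
Proof.
move=> fg; rewrite /sph_int; congr (_ * _)%E.
have -> : [set t | 0 < enorm (tup2rv t) <= 1 /\ sphere (normalize (tup2rv t))] =
    @punctured_ball R n.
  by apply/seteqP; split => t; [case|move=> Dt; split => //; exact: direction_sphere].
by apply: eq_integral => t /set_mem/direction_sphere St; rewrite fg.
Qed.

(** The factor [n] of the cone measure cancels [n^-1]. Deleting [Z] will put the quermassintegrals
    on the same regular set as the curvature integral. *)
Lemma dual_quermassE (q j : R) (K Q : set V) (f : V -> R) (Z : set (n.-tuple R)) :
  (0 < n)%N -> (forall u, u != 0 -> {for u, continuous f}) ->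
  (forall u, sphere u -> 0 <= f u) ->
  (forall u, sphere u -> radial K u `^ q * radial Q u `^ (n%:R - q - j) = f u) ->
  measurable Z -> lam Z = 0%E ->
  dual_quermass lam q j K Q = \int[lam]_(t in punctured_ball `\` Z) f (direction t).
Proof.
move=> n0 cf f0 Kf mZ Z0; rewrite /dual_quermass (sph_int_sphere _ f)//.
have iD := integrable_direction _ cf _ _ lamL measurable_punctured_ball (@subset_refl _ _).
rewrite fineM//; last exact: (integrable_fin_num measurable_punctured_ball iD).
rewrite mulrA mulVf ?pnatr_eq0 -?lt0n// mul1r /Rintegral; congr fine.
apply: ge0_negligible_integral => //.
- exact: measurable_punctured_ball.
- by apply/measurable_EFinP; exact: (measurable_fun_direction _ cf).
- by move=> t /direction_sphere St; rewrite lee_fin f0.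
Qed.

End Quermass.

(** * Differentiation under the integral sign *)

Section Variation.
Context {R : realType} {n : nat}.
Local Notation V := 'rV[R]_n.
Variables (lam mu : {measure set (n.-tuple R) -> \bar R}).
Variables (p q j : R) (M N Q : set V).
Hypothesis lamL : is_lebesgue lam.
Hypothesis p0 : p != 0.
Hypothesis bM : convex_body_o M.
Hypothesis bN : convex_body_o N.
Hypothesis bQ : star_body_o Q.
Hypothesis muE : forall eta : set (n.-tuple R), measurable eta ->
  mu eta = dual_curv lam q j M Q ((tup2rv @` eta) `&` sphere).
Hypothesis S0 : @sphere R n !=set0.

Let h := hsupp M.
Let k := hsupp N.

Let hc v : sphere v -> {for v, continuous h}.
Proof. by move=> _; exact: continuous_hsupp_body. Qed.
Let kc v : sphere v -> {for v, continuous k}.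
Proof. by move=> _; exact: continuous_hsupp_body. Qed.
Let h0 v : sphere v -> 0 < h v.
Proof. by move=> /sphere_neq0; exact: hsupp_body_gt0. Qed.
Let k0 v : sphere v -> 0 < k v.
Proof. by move=> /sphere_neq0; exact: hsupp_body_gt0. Qed.

Let n0 : (0 < n)%N. Proof. exact: sphere_dim_gt0 S0. Qed.

Let T0 : setT `&` @sphere R n !=set0. Proof. by case: S0 => v; exists v. Qed.

Let s (u : V) := radial Q u `^ (n%:R - q - j).

Let s_gt0 u : u != 0 -> 0 < s u.
Proof. by move=> u0; rewrite powR_gt0//; apply: (star_body_radial _ bQ).1. Qed.

Let s_cont u : u != 0 -> {for u, continuous s}.
Proof.
move=> u0; have [Q0 cQ] := star_body_radial _ bQ.
exact: (@continuous_comp _ _ _ (radial Q) (fun y => y `^ _)) (cQ _ u0)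
  (continuous_powR _ _ (Q0 _ u0)).
Qed.

(* the integrand of the dual mixed quermassintegral of the Wulff shape of g *)
Let I (g : V -> R) (u : V) := (gauge g setT u)^-1 `^ q * s u.

Let I_cont (g : V -> R) : (forall v, sphere v -> {for v, continuous g}) ->
  (forall v, sphere v -> 0 < g v) -> forall u, u != 0 -> {for u, continuous (I g)}.
Proof.
move=> gc g0 u u0.
have gu := gauge_gt0 _ gc g0 _ u0.
apply: (@continuousM _ _ (fun u => (gauge g setT u)^-1 `^ q) s); last exact: s_cont.
have Vc : {for u, continuous (fun u => (gauge g setT u)^-1)}.
  apply: continuousV; first by rewrite gt_eqF.
  exact: (continuous_gauge _ _ gc g0 closedT T0).
apply: (@continuous_comp _ _ _ (fun u => (gauge g setT u)^-1) (fun y => y `^ q)) Vc _.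
by apply: continuous_powR; rewrite invr_gt0.
Qed.

Let I_gt0 (g : V -> R) : (forall v, sphere v -> {for v, continuous g}) ->
  (forall v, sphere v -> 0 < g v) -> forall u, u != 0 -> 0 < I g u.
Proof.
by move=> gc g0 u u0; rewrite mulr_gt0 ?s_gt0// powR_gt0// invr_gt0 gauge_gt0.
Qed.

Let w := I h \o @direction R n.

Let mw : measurable_fun punctured_ball w.
Proof. by apply: measurable_fun_direction => // u; exact: I_cont. Qed.

Let w0 t : punctured_ball t -> 0 < w t.
Proof. by move=> /direction_neq0; exact: I_gt0. Qed.

Let iw : (\int[lam]_(t in punctured_ball) (w t)%:E < +oo)%E.
Proof.
have := integrable_direction _ (I_cont _ hc h0) _ _ lamL measurable_punctured_ball
  (@subset_refl _ _).
by move=> /(integrable_lty measurable_punctured_ball).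
Qed.

Let radialM u : u != 0 -> radial M u = (gauge h setT u)^-1.
Proof. by move=> u0; rewrite -radial_wulff// body_wulff. Qed.

(** Since the radial function of [M] is the reciprocal of the gauge, the support condition in the
    reverse radial Gauss image is the equality in [contact_normal]. *)
Let mu_contact eta : measurable eta ->
  mu eta = (\int[lam]_(t in contact h (tup2rv @` eta)) (w t)%:E)%E.
Proof.
move=> meta; rewrite muE// /dual_curv /sph_int muleA -EFinM.
rewrite mulVf ?pnatr_eq0 -?lt0n// mul1e.
have -> : [set t | 0 < enorm (tup2rv t) <= 1 /\
    rev_radial_gauss M (tup2rv @` eta `&` sphere) (normalize (tup2rv t))] =
    contact h (tup2rv @` eta).
  apply/seteqP; split => t [Dt].
    have dt0 := direction_neq0 _ Dt; have g0 := gauge_gt0 _ hc h0 _ dt0.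
    move=> [_ [v [ev Sv]]]; rewrite -[normalize _]/(direction t) radialM// dotZl => /esym Mv.
    have {}Mv : h v = (gauge h setT (direction t))^-1 * dot (direction t) v := Mv.
    split => //; exists v => //; split => //.
    rewrite [in RHS]Mv invfM invrK mulrCA mulfV ?mulr1//.
    by apply/eqP => d0; have := h0 _ Sv; rewrite Mv d0 mulr0 ltxx.
  have dt0 := direction_neq0 _ Dt; have g0 := gauge_gt0 _ hc h0 _ dt0.
  move=> [v ev [Sv gv]]; split => //; split; first exact: direction_sphere.
  exists v => //; rewrite -[normalize _]/(direction t) radialM// dotZl.
  have -> : dot (direction t) v = gauge h setT (direction t) * h v.
    by rewrite gv divfK// (lt0r_neq0 (h0 _ Sv)).
  by rewrite (mulKf (lt0r_neq0 g0)).
apply: eq_integral => t /set_mem[/direction_neq0 Dt _].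
by rewrite -[normalize _]/(direction t) radialM.
Qed.

Let E := regular_ball h.

Let mE : measurable E. Proof. exact: measurable_regular_ball. Qed.

Let E_sub : E `<=` punctured_ball. Proof. by move=> t []. Qed.

Let normal t := radial_gauss h t.

Let ratio_cont v : v != 0 -> {for v, continuous (lp_ratio h k p)}.
Proof.
move=> v0; apply: lp_ratio_continuous.
- exact: continuous_hsupp_body.
- exact: continuous_hsupp_body.
- exact: hsupp_body_gt0.
- exact: hsupp_body_gt0.
Qed.

Let m_ratio (D : set (n.-tuple R)) : D `<=` tup2rv @^-1` sphere ->
  measurable_fun D (lp_ratio h k p \o tup2rv).
Proof.
move=> DS; apply: (measurable_fun_tup2rv _ _ _ open_neq0) => [t /DS|v].
  exact: sphere_neq0.
exact: ratio_cont.
Qed.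

Let m_ratio_normal : measurable_fun E (fun t => lp_ratio h k p (normal t)).
Proof.
have -> : (fun t => lp_ratio h k p (normal t)) =
    (lp_ratio h k p \o tup2rv) \o (rv2tup \o radial_gauss h).
  by apply/funext => t /=; rewrite rv2tupK.
apply: (@measurable_comp _ _ _ _ _ _ (tup2rv @^-1` sphere)).
- by apply: measurable_tup2rv_closed; exact: compact_closed sphere_compact.
- move=> _ [t /E_sub Dt <-] /=; rewrite rv2tupK.
  by have [] := radial_gaussP _ hc h0 _ Dt.
- exact: m_ratio.
- exact: measurable_radial_gauss.
Qed.

(** The density h_M^(-p) that turns the [q]-th measure into the (p,q)-th joins h_N^p to form
    [lp_ratio], evaluated at the normal after the change of variables. *)
Lemma integral_lp_ratio :
  (\int[mu]_(t in tup2rv @^-1` sphere)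
    (hsupp N (tup2rv t) `^ p * hsupp M (tup2rv t) `^ (- p))%:E =
  \int[lam]_(t in E) (lp_ratio h k p (normal t) * w t)%:E)%E.
Proof.
rewrite (integral_radial_gauss _ hc h0 _ _ _ mw w0 iw mu_contact
  (fun t => (lp_ratio h k p (tup2rv t))%:E)).
- by apply: eq_integral => t _; rewrite rv2tupK -EFinM.
- by apply/measurable_EFinP; exact: (m_ratio _ (@subset_refl _ _)).
- by move=> y /(lp_ratio_gt0 _ _ p h0 k0)/ltW; rewrite lee_fin.
Qed.

Let Z0 : lam (multinormal h) = 0%E.
Proof. exact: (multinormal_null _ hc h0 _ _ _ mw w0 iw mu_contact). Qed.

Let mZ : measurable (multinormal h). Proof. exact: measurable_multinormal. Qed.

Lemma dual_quermass_derivative :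
  (fun t => (dual_quermass lam q j (wulff_p M N p t) Q
             - dual_quermass lam q j M Q) / t) @ 0^' -->
  q / p * fine (\int[mu]_(t in tup2rv @^-1` sphere)
                  (hsupp N (tup2rv t) `^ p * hsupp M (tup2rv t) `^ (- p))%:E).
Proof.
rewrite integral_lp_ratio.
have [B B0 ratioB] := lp_ratio_bounded _ _ p hc kc h0 k0.
have [C [d [C0 d0 lip]]] := gauge_pow_lipschitz _ _ _ p0 hc kc h0 k0 _ B0 ratioB q.
pose e := Num.min d (2^-1 / B).
have e0 : 0 < e by rewrite lt_min d0 divr_gt0// invr_gt0.
have small (t : R) : `|t| < e -> `|t| < d /\ `|t| * B <= 2^-1.
  by rewrite lt_min => /andP[-> tB]; rewrite -ler_pdivlMr// ltW.
pose H (t : R) := lp_comb h k p t.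
have Hc (t : R) : `|t| < e -> forall v, sphere v -> {for v, continuous (H t)}.
  by move=> /small[_ tB] v; exact: (lp_comb_continuous _ _ _ hc kc h0 k0 _ ratioB).
have H0 (t : R) : `|t| < e -> forall v, sphere v -> 0 < H t v.
  by move=> /small[_ tB] v; exact: (lp_comb_gt0 _ _ _ p0 h0 k0 _ ratioB).
pose D (t : R) x := (I (H t) (direction x) - I h (direction x)) / t.
have iI (g : V -> R) (gc : forall v, sphere v -> {for v, continuous g})
    (gp : forall v, sphere v -> 0 < g v) :
    lam.-integrable E (EFin \o (I g \o @direction R n)).
  exact: (integrable_direction _ (I_cont _ gc gp) _ _ lamL mE E_sub).
have WM : dual_quermass lam q j M Q = \int[lam]_(x in E) I h (direction x).
  apply: (dual_quermassE _ lamL _ _ _ _ _ _ n0 (I_cont _ hc h0)) => // u Su.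
    by apply/ltW/I_gt0 => //; exact: sphere_neq0.
  by rewrite radialM//; exact: sphere_neq0.
have Wt (t : R) : `|t| < e ->
    dual_quermass lam q j (wulff_p M N p t) Q = \int[lam]_(x in E) I (H t) (direction x).
  move=> te.
  apply: (dual_quermassE _ lamL _ _ _ _ _ _ n0 (I_cont _ (Hc _ te) (H0 _ te))) => // u Su.
    by apply/ltW/I_gt0; [exact: Hc|exact: H0|exact: sphere_neq0].
  by congr (_ `^ _ * _); apply: radial_wulff; [exact: Hc|exact: H0|exact: sphere_neq0].
have DE (t : R) : `|t| < e -> (dual_quermass lam q j (wulff_p M N p t) Q
    - dual_quermass lam q j M Q) / t = fine (\int[lam]_(x in E) (D t x)%:E)%E.
  move=> te; rewrite Wt// WM -RintegralB//; last 2 first.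
  - exact: iI (Hc _ te) (H0 _ te).
  - exact: iI.
  rewrite -RintegralZr//.
  exact: integrableB (iI _ (Hc _ te) (H0 _ te)) (iI _ hc h0).
(* Dominated convergence concerns sequences, so the limit is tested along nonzero sequences tending
   to 0; the shift by [m] keeps every term below [e] in absolute value. *)
apply/cvgr_dnbhsP => u [u0 ucvg].
have /cvgrPdist_lt/(_ _ e0)[m _ um] := ucvg.
have {}um i : `|u (i + m)%N| < e.
  by have := um (i + m)%N (leq_addl _ _); rewrite /= sub0r normrN.
rewrite -(cvg_shiftn m) /=.
under eq_fun do rewrite DE//.
have mD i : measurable_fun E (D (u (i + m)%N)).
  apply: measurable_funM; last exact: measurable_cst.
  apply: (@measurable_funB _ _ _ _ (I (H (u (i + m)%N)) \o @direction R n) w).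
    exact: (measurable_fun_direction _ (I_cont _ (Hc _ (um i)) (H0 _ (um i)))).
  exact: (measurable_fun_direction _ (I_cont _ hc h0)).
pose f x := q / p * (lp_ratio h k p (normal x) * w x).
have mf : measurable_fun E f.
  apply: measurable_funM; first exact: measurable_cst.
  apply: measurable_funM; first exact: m_ratio_normal.
  by apply: measurable_funS mw => //; exact: measurable_punctured_ball.
have dominated i x : E x -> `|D (u (i + m)%N) x| <= C * w x.
  move=> /E_sub/direction_neq0 x0; have [ud _] := small (u (i + m)%N) (um i).
  rewrite /D /w /= /I -mulrBl mulrAC normrM (gtr0_norm (s_gt0 _ x0)).
  by rewrite mulrA ler_wpM2r ?(ltW (s_gt0 _ x0))// lip.
have pointwise x : E x -> D (u (i + m)%N) x @[i --> \oo] --> f x.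
  move=> [Dx Zx]; have x0 := direction_neq0 _ Dx.
  have [Sv gv] := radial_gaussP _ hc h0 _ Dx.
  have uniq v : sphere v -> gauge h setT (direction x) = dot (direction x) v / h v ->
      v = radial_gauss h x.
    by move=> Sv' gv'; apply: (contact_normal_unique _ _ _ _ Dx Zx).
  have /cvgr_dnbhsP/(_ _ (conj u0 ucvg)) :=
    gauge_pow_derivative _ _ _ p0 hc kc h0 k0 _ B0 ratioB q _ _ x0 Sv gv uniq.
  rewrite -(cvg_shiftn m) => lim.
  have -> : f x = q / p * lp_ratio h k p (normal x) *
      (gauge h setT (direction x))^-1 `^ q * s (direction x).
    by rewrite /f /w /= /I !mulrA.
  have -> : (fun i => D (u (i + m)%N) x) = fun i =>
      ((gauge (H (u (i + m)%N)) setT (direction x))^-1 `^ q -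
       (gauge h setT (direction x))^-1 `^ q) / u (i + m)%N * s (direction x).
    by apply/funext => i; rewrite /D /I -mulrBl mulrAC.
  by apply: cvgM lim _; exact: cvg_cst.
have pointwiseE x : E x -> (D (u (i + m)%N) x)%:E @[i --> \oo] --> (f x)%:E.
  by move=> Ex; apply: cvg_EFin; [exact: nearW|exact: pointwise].
have [if_ _ lim] := @dominated_convergence _ _ _ lam E mE
  (fun i x => (D (u (i + m)%N) x)%:E) (EFin \o f) (fun x => (C * w x)%:E)
  (fun i => iffRL (measurable_EFinP _ _) (mD i)) (iffRL (measurable_EFinP _ _) mf)
  (aeW _ pointwiseE)
  (integrableZl mE _ (iI _ hc h0))
  (aeW _ (fun x i Ex => dominated i x Ex)).
(* Integrable because [lp_ratio] is at most [B]; this permits taking [q / p] out of the integral. *)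
have ilpw : lam.-integrable E (EFin \o (fun x => lp_ratio h k p (normal x) * w x)).
  apply: (le_integrable mE _ _ (integrableZl mE B (iI _ hc h0))).
    apply/measurable_EFinP; apply: measurable_funM => //.
    by apply: measurable_funS mw => //; exact: measurable_punctured_ball.
  move=> x /E_sub Dx; have [Sv _] := radial_gaussP _ hc h0 _ Dx.
  have wx : 0 <= w x by rewrite ltW// w0.
  rewrite -[leRHS]/(`|(B * w x)%:E|)%E !abse_EFin lee_fin (normrM _ (w x)) (normrM B (w x)).
  rewrite (ger0_norm wx) ler_wpM2r//.
  rewrite (gtr0_norm B0) gtr0_norm ?ratioB//.
  exact: lp_ratio_gt0.
rewrite -[fine _]/(\int[lam]_(x in E) (lp_ratio h k p (normal x) * w x))%R.
rewrite -RintegralZl//.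
by apply: fine_cvg; rewrite /Rintegral fineK//; exact: (integrable_fin_num mE if_).
Qed.

End Variation.

Theorem theorem4p4 (R : realType) (n : nat)
    (lam : {measure set (n.-tuple R) -> \bar R})
    (mu : {measure set (n.-tuple R) -> \bar R})
    (p q j : R) (M N Q : set 'rV[R]_n) :
  is_lebesgue lam ->
  p != 0 -> q != 0 -> j != n%:R ->
  convex_body_o M -> convex_body_o N -> star_body_o Q ->
  (* mu is the dual mixed curvature measure C~_{q,j}(M,Q,.) on S^{n-1} *)
  (forall eta : set (n.-tuple R), measurable eta ->
     mu eta = dual_curv lam q j M Q ((tup2rv @` eta) `&` sphere)) ->
  (fun t => (dual_quermass lam q j (wulff_p M N p t) Q
             - dual_quermass lam q j M Q) / t) @ 0^' -->
  q / p * fine (\int[mu]_(t in tup2rv @^-1` sphere)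
                  (hsupp N (tup2rv t) `^ p * hsupp M (tup2rv t) `^ (- p))%:E).
Proof.
move=> lamL p0 _ _ bM bN bQ muE.
have [S0|S0] := pselect (@sphere R n !=set0).
  exact: dual_quermass_derivative.
(* n = 0: the sphere is empty and both sides vanish *)
have SE v : ~ @sphere R n v by move=> Sv; apply: S0; exists v.
have W0 (K : set 'rV[R]_n) : dual_quermass lam q j K Q = 0.
  rewrite /dual_quermass /sph_int (_ : [set _ | _] = set0).
    by rewrite integral_set0 mule0 mulr0.
  by apply/seteqP; split => // t [_ /SE].
rewrite (_ : tup2rv @^-1` sphere = set0); last by apply/seteqP; split => // t /SE.
rewrite integral_set0 mulr0.
under eq_fun do rewrite !W0 subrr mul0r.
exact: cvg_cst.
Qed.
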